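(* The third Houghton group $H_3$, which is finitely presented, acts properly, preserving factors, on a product of three trees, but does not act properly (whether preserving factors or not) on the product of any finite number of locally finite trees.
   Context: The third Houghton group $H_3$ is the group of all bijections $g$ of the set $X=\{1,2,3\}\times\mathbb{N}$ that are eventually a translation on each of the three prongs $P_i=\{(i,m): m\in\mathbb{N}\}$, i.e. such that there are integers $t_1(g),t_2(g),t_3(g)$ with $g(i,m)=(i,m+t_i(g))$ for each $i$ and all sufficiently large $m$. All trees are simplicial trees, regarded as metric spaces with each edge of length 1. A tree is locally finite if every vertex has finite valence. A finite product $P=T_1\times\dots\times T_n$ of trees carries its natural cube complex structure (and the $\ell_2$ product metric). An action of a group $G$ on $P$ is a homomorphism from $G$ to the group $\mathrm{Aut}(P)$ of automorphisms of the cube complex $P$; it may permute factors, may invert edges, and need not be faithful. The action preserves factors if its image lies in $\mathrm{Aut}(T_1)\times\dots\times \mathrm{Aut}(T_n)$, where $\mathrm{Aut}(T_i)$ is the group of simplicial automorphisms of $T_i$. The action is proper if the stabiliser in $G$ of every vertex of $P$ is a finite group. *)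

(* Defs.v *)
From HB Require Import structures.
From mathcomp Require Import all_boot ssralg ssrnum ssrint zify.
From mathcomp Require Import boolp classical_sets cardinality.

Set Implicit Arguments.
Unset Strict Implicit.
Unset Printing Implicit Defensive.

Import GRing.Theory.

Local Open Scope classical_set_scope.
Local Open Scope group_scope.

Record sym (X : Type) := Sym {
  sym_fun :> X -> X;
  sym_bij : bijective sym_fun }.

HB.instance Definition _ (X : Type) := gen_eqMixin (sym X).
HB.instance Definition _ (X : Type) := gen_choiceMixin (sym X).

Section SymGroup.
Variable X : Type.
Implicit Types f g h : sym X.

Lemma sym_ext f g : f =1 g -> f = g.
Proof.
case: f g => [f bf] [g bg] /= /funext fg; rewrite fg in bf *.
by rewrite (Prop_irrelevance bf bg).
Qed.

Lemma sym_inv_exists f : exists g : X -> X, cancel f g /\ cancel g f.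
Proof. by case: (sym_bij f) => g fK gK; exists g. Qed.

Definition sym_inv_fun f : X -> X := projT1 (cid (sym_inv_exists f)).

Lemma sym_funK f : cancel f (sym_inv_fun f).
Proof. by rewrite /sym_inv_fun; case: cid => g []. Qed.

Lemma sym_inv_funK f : cancel (sym_inv_fun f) f.
Proof. by rewrite /sym_inv_fun; case: cid => g []. Qed.

Definition sym_one : sym X := Sym (Bijective (frefl id) (frefl id)).
Definition sym_inv f : sym X := Sym (Bijective (sym_inv_funK f) (sym_funK f)).
Definition sym_mul f g : sym X := Sym (bij_comp (sym_bij f) (sym_bij g)).

Lemma sym_mulA : associative sym_mul.
Proof. by move=> f g h; apply: sym_ext. Qed.
Lemma sym_mul1 : left_id sym_one sym_mul.
Proof. by move=> f; apply: sym_ext. Qed.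
Lemma sym_1mul : right_id sym_one sym_mul.
Proof. by move=> f; apply: sym_ext. Qed.
Lemma sym_mulV : left_inverse sym_one sym_inv sym_mul.
Proof. by move=> f; apply: sym_ext => x /=; rewrite sym_funK. Qed.
Lemma sym_Vmul : right_inverse sym_one sym_inv sym_mul.
Proof. by move=> f; apply: sym_ext => x /=; rewrite sym_inv_funK. Qed.

HB.instance Definition _ := isGroup.Build (sym X)
  sym_mulA sym_mul1 sym_1mul sym_mulV sym_Vmul.

Lemma symME f g x : (f * g) x = f (g x). Proof. by []. Qed.
Lemma sym1E x : (1 : sym X) x = x. Proof. by []. Qed.
Lemma symVK f : cancel f (f^-1). Proof. exact: sym_funK. Qed.
Lemma symKV f : cancel (f^-1) f. Proof. exact: sym_inv_funK. Qed.

End SymGroup.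

(* On {1..n} x nat, [t i] is the translation length of [g] on the prong [i];
   the equation is taken in [int] since [t i] may be negative. *)
Definition eventually_translation (n : nat) (g : sym ('I_n * nat)) : Prop :=
  exists t : 'I_n -> int, forall i : 'I_n, exists N : nat, forall m : nat,
    (N <= m)%N ->
    (g (i, m)).1 = i /\ ((g (i, m)).2%:Z = m%:Z + t i :> int)%R.

Definition is_houghton (n : nat) : pred (sym ('I_n * nat)) :=
  fun g => `[< eventually_translation g >].

Lemma is_houghton_closed n : group_closed (@is_houghton n).
Proof.
split.
  apply/asboolP; exists (fun=> 0%R) => i; exists 0%N => m _.
  by rewrite sym1E addr0.
move=> f g /asboolP[t ft] /asboolP[u gu]; apply/asboolP.
exists (fun i => (t i - u i)%R) => i.
have [N fN] := ft i; have [M gM] := gu i.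
exists (N + M + `|u i|)%N => m le_m; rewrite symME.
have [k mk] : exists k : nat, (k%:Z = m%:Z - u i)%R.
  by exists `|(m%:Z - u i)%R|%N; lia.
have [gk1 gk2] : _ /\ _ := gM k ltac:(lia).
have gk : g (i, k) = (i, m).
  by rewrite [LHS]surjective_pairing gk1; congr (_, _); lia.
rewrite -gk symVK; have [-> ->] : _ /\ _ := fN k ltac:(lia).
by split=> //; lia.
Qed.

Record houghton (n : nat) := Houghton {
  houghton_val :> sym ('I_n * nat);
  _ : houghton_val \in @is_houghton n }.

HB.instance Definition _ n := [isSub of houghton n for @houghton_val n].
HB.instance Definition _ n := [Choice of houghton n by <:].
HB.instance Definition _ n :=
  SubChoice_isSubGroup.Build _ _ (houghton n) (@is_houghton_closed n).

(* A word in n generators is a sequence of letters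
   (i, e) standing for x_i, or for x_i^-1 when e is true; words modulo
   [word_eq rels] form the group < x_0, ..., x_(n-1) | rels >. *)
Definition word (n : nat) := seq ('I_n * bool).

Inductive word_eq (n : nat) (rels : seq (word n)) : word n -> word n -> Prop :=
| word_eq_refl u : word_eq rels u u
| word_eq_sym u v : word_eq rels u v -> word_eq rels v u
| word_eq_trans u v w :
    word_eq rels u v -> word_eq rels v w -> word_eq rels u w
| word_eq_cancel u v i e : word_eq rels (u ++ [:: (i, e); (i, ~~ e)] ++ v) (u ++ v)
| word_eq_rel u v r : r \in rels -> word_eq rels (u ++ r ++ v) (u ++ v).

Definition word_eval (G : groupType) (n : nat) (x : 'I_n -> G) (w : word n) : G :=
  \prod_(a <- w) (if a.2 then (x a.1)^-1 else x a.1).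

Definition finitely_presented (G : groupType) : Prop :=
  exists (n : nat) (x : 'I_n -> G) (rels : seq (word n)),
    (forall g : G, exists w : word n, word_eval x w = g) /\
    (forall u v : word n, word_eval x u = word_eval x v <-> word_eq rels u v).

Record tree := Tree {
  tree_vertex :> choiceType;
  adj : rel tree_vertex;
  _ : inhabited tree_vertex;
  adj_sym : symmetric adj;
  adj_irr : irreflexive adj;
  tree_connected : forall v w, exists2 p, path adj v p & last v p = w;
  (* [:: v; w] is a [ucycle] for each edge vw, hence the bound 2 *)
  tree_acyclic : forall c, ucycle adj c -> (size c <= 2)%N }.

Definition locally_finite (T : tree) : Prop :=
  forall v : T, finite_set [set w : T | adj v w].

(* The cells of a tree, and of a product of trees, are identified with their
   vertex sets. *)
Definition simplices (T : tree) : set (set T) :=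
  [set s | (exists v : T, s = [set v]) \/
           (exists v w : T, adj v w /\ s = [set v; w])].
Arguments simplices : clear implicits.

Definition vertices (n : nat) (T : 'I_n -> tree) : Type := forall i : 'I_n, T i.

Definition cubes (n : nat) (T : 'I_n -> tree) : set (set (vertices T)) :=
  [set c | exists s : forall i : 'I_n, set (T i),
     (forall i, simplices (T i) (s i)) /\
     c = [set x : vertices T | forall i, s i (x i)]].
Arguments cubes {n} T _.

(* Automorphisms of the complex with vertex set V and cells C.  In a product
   of trees the faces of a cube are the cubes contained in it, so these maps
   preserve the whole combinatorial structure. *)
Definition is_aut (V : Type) (C : set (set V)) : pred (sym V) :=
  fun f => `[< forall c : set V, C (f @` c) <-> C c >].

Lemma is_aut_closed V (C : set (set V)) : group_closed (is_aut C).
Proof.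
split; first by apply/asboolP => c; rewrite image_id.
move=> f g /asboolP fC /asboolP gC; apply/asboolP => c.
rewrite (_ : _ @` c = f @` ((g^-1) @` c)); last by rewrite image_comp.
rewrite fC -gC (_ : g @` _ = c) // image_comp.
by rewrite (_ : _ \o _ = id) ?image_id //; apply/funext=> x; apply: symKV.
Qed.

Record aut (V : Type) (C : set (set V)) := Aut {
  aut_val :> sym V;
  _ : aut_val \in is_aut C }.

HB.instance Definition _ V C := [isSub of @aut V C for @aut_val V C].
HB.instance Definition _ V C := [Choice of @aut V C by <:].
HB.instance Definition _ V C :=
  SubChoice_isSubGroup.Build _ _ (@aut V C) (@is_aut_closed V C).

Section Actions.
Variables (G : groupType) (n : nat) (T : 'I_n -> tree).

(* Products in [sym] are [(f * g) x = f (g x)], so this is a left action. *)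
Definition action : Type := UMagmaMorphism.type G (aut (cubes T)).

Definition preserves_factors (rho : action) : Prop :=
  forall g : G, exists phi : forall i : 'I_n, aut (simplices (T i)),
    forall (x : vertices T) (i : 'I_n), rho g x i = phi i (x i).

Definition proper_action (rho : action) : Prop :=
  forall x : vertices T, finite_set [set g : G | rho g x = x].

End Actions.

(* Main.v *)
(* Finite presentation.  Add a base point to the three prongs (the origin of the
   first prong plays this role).  Take as generators the three shifts g_i fixing
   the base point and one prong, and the transpositions t_i of the base point
   with the origins of the prongs.  Finitely many relations make every
   transposition T_x of the base point with a point x well defined as a conjugate
   of some t_i, permuted by the g_i as the points are.  Since the g_i generate a
   group that is transitive on triples of points, one braid relation and one
   commutation relation then give all the relations of the group of finitary
   permutations.  Modulo the T_x the g_i commute, so an element is a product of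
   T_x's times g_0^a g_1^b, and translation lengths detect a and b.

   Proper action.  The tree of the prong i has as vertices the sequences of points
   that are eventually a tail of that prong; dropping the first term gives the
   parent.  An element fixing a vertex of each tree fixes almost all points.

   No proper action on locally finite trees.  An automorphism of a product of
   trees permutes the factors.  Put s = g^N and u = h^N, where g and h translate
   the first prong to the second and to the third, and N is such that s and u
   preserve each factor.  The elements s, u and s u^-1 each fix a prong pointwise,
   so they commute with the 3-cycles on it.  If one of them fixes no vertex of the
   factor T, these 3-cycles all fix a vertex of T at minimal displacement; having
   no finite quotient they fix its neighbours, hence all of T.  Otherwise s and u
   have a common fixed vertex; then powers of s and u act trivially on any given
   ball, and conjugating by them makes the supports of two finitary elements of
   <s, u> disjoint, so their commutator acts trivially on T.  In both cases all
   3-cycles act trivially on T. *)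
From HB Require Import structures.
Require Import Defs.
From mathcomp Require Import all_boot order ssralg ssrnum ssrint zify.
From mathcomp Require Import boolp classical_sets cardinality.

Set Implicit Arguments.
Unset Strict Implicit.
Unset Printing Implicit Defensive.

Import Order.TTheory GRing.Theory Num.Theory.

Local Open Scope classical_set_scope.
Local Open Scope group_scope.

(** * Metric geometry of trees *)

Lemma exists_argmin (A : Type) (P : A -> Prop) (f : A -> nat) a :
  P a -> exists2 x, P x & forall y, P y -> (f x <= f y)%N.
Proof.
move=> Pa; have exP : exists n, `[< exists2 x, P x & f x = n >].
  by exists (f a); apply/asboolP; exists a.
case: (ex_minnP exP) => m /asboolP[x Px <-] min_m; exists x => // y Py.
by apply: min_m; apply/asboolP; exists y.
Qed.

Section TreeMetric.
Variable T : tree.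
Implicit Types (a b c v w x y z : T) (p q : seq T) (C : T -> Prop).

Definition spath v w p :=
  [/\ path (@adj T) v p, last v p = w & uniq (v :: p)].

Lemma spath_exists v w : exists p, spath v w p.
Proof.
have [p pP <-] := tree_connected v w.
by case/shortenP: pP => p' p'P up' _; exists p'.
Qed.

(** If the first steps differ, the first vertex [z] of one path that lies on the other closes up a
    simple cycle through [v]. *)
Lemma spath_unique v w p q : spath v w p -> spath v w q -> p = q.
Proof.
elim: p v q => [|x p IHp] v [|y q] //.
- case=> _ /= <- _ [_ /= e /andP[/negP[]]].
  by rewrite -{1}e mem_last.
- case=> _ /= e /andP[/negP h _] [_ /= e' _]; case: h.
  by rewrite e' -{1}e mem_last.
move=> [/= /andP[vx px] ew /and3P[]]; rewrite inE negb_or => /andP[nvx vp] xp up.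
move=> [/= /andP[vy qy] ew' /and3P[]]; rewrite inE negb_or => /andP[nvy vq] yq uq.
have [exy|nxy] := eqVneq x y.
  rewrite exy in px ew xp *; congr (_ :: _); apply: (IHp y) => //.
    by split=> //=; apply/andP.
  by split=> //=; apply/andP.
have [z [p1 [p2 [zq nq1 exp]]]] : exists z p1 p2,
    [/\ z \in y :: q, ~~ has [in y :: q] p1 & x :: p = p1 ++ z :: p2].
  have : has [in y :: q] (x :: p).
    by apply/hasP; exists w; [rewrite -ew mem_last|rewrite -ew' mem_last].
  by case/split_find => z p1 p2 zq nq1; exists z, p1, p2; rewrite cat_rcons.
have [q1 [q2 eyq]] : exists q1 q2, y :: q = q1 ++ z :: q2.
  by case/splitPr: zq => q1 q2; exists q1, q2.
have up1 : uniq (v :: x :: p) by rewrite /= inE negb_or nvx vp xp.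
have uq1 : uniq (v :: y :: q) by rewrite /= inE negb_or nvy vq yq.
have pp1 : path (@adj T) v (x :: p) by rewrite /= vx.
have pq1 : path (@adj T) v (y :: q) by rewrite /= vy.
have : ucycle (@adj T) (v :: p1 ++ z :: rev q1).
  apply/andP; split.
    rewrite /= rcons_cat /= cat_path /=.
    move: pp1; rewrite exp cat_path /= => /and3P[-> -> _] /=.
    move: pq1; rewrite eyq -cat_rcons cat_path => /andP[pq1 _].
    have := rev_path (@adj T) v (rcons q1 z).
    rewrite last_rcons belast_rcons rev_cons => ->.
    by rewrite (eq_path (e' := @adj T)) // => s t; rewrite adj_sym.
  move: up1; rewrite exp -cat_cons cat_uniq => /and3P[up1 /hasPn/(_ z) zp1 _].
  move: uq1; rewrite eyq /= mem_cat negb_or cat_uniq => /andP[/andP[vq1 _]].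
  move=> /and3P[uq1 /hasPn/(_ z) dq1 _].
  change (is_true (uniq ((v :: p1) ++ z :: rev q1))).
  rewrite cat_uniq up1 /= rev_uniq uq1 mem_rev andbT.
  rewrite negb_or zp1 ?inE ?eqxx //= dq1 ?inE ?eqxx // andbT.
  apply/hasPn => t; rewrite mem_rev => tq1; rewrite inE negb_or.
  apply/andP; split; first by apply: contra vq1 => /eqP <-.
  apply: contra nq1 => tp1; apply/hasP; exists t => //=.
  by rewrite eyq mem_cat tq1.
(* The bound 2 leaves [p1] and [q1] empty, whence [x = z = y]. *)
move/tree_acyclic; rewrite /= size_cat /= size_rev.
case: p1 q1 exp eyq {nq1} => [|??] [|??] //=; rewrite ?addnS //.
by move=> [exz _] [eyz _]; rewrite exz eyz eqxx in nxy.
Qed.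

Definition geo v w : seq T := projT1 (cid (spath_exists v w)).

Lemma geoP v w : spath v w (geo v w).
Proof. by rewrite /geo; case: cid. Qed.

Lemma geo_path v w : path (@adj T) v (geo v w). Proof. by case: (geoP v w). Qed.
Lemma geo_last v w : last v (geo v w) = w. Proof. by case: (geoP v w). Qed.
Lemma geo_uniq v w : uniq (v :: geo v w). Proof. by case: (geoP v w). Qed.

Lemma geoE v w p : spath v w p -> geo v w = p.
Proof. exact: spath_unique (geoP v w). Qed.

Definition dist v w : nat := size (geo v w).

Lemma dist_path v p : path (@adj T) v p -> (dist v (last v p) <= size p)%N.
Proof.
move=> pP; rewrite /dist; case/shortenP: pP => p' p'P up' sp.
rewrite (geoE (p := p')) //; apply: uniq_leq_size sp.
by case/andP: up'.
Qed.

Lemma dist_path_geo v p :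
  path (@adj T) v p -> (size p <= dist v (last v p))%N -> geo v (last v p) = p.
Proof.
move=> pP; rewrite /dist => szp; apply: geoE; split => //.
move: szp; case/shortenP: (pP) => p' p'P up' sp; rewrite (geoE (p := p')) //.
case/andP: up' => vp' up' szp /=.
rewrite (leq_size_uniq up' sp szp) andbT; have [_ e] := uniq_min_size up' sp szp.
by rewrite -e.
Qed.

Lemma distxx v : dist v v = 0.
Proof. by rewrite /dist (geoE (p := [::])). Qed.

Lemma dist0 v w : dist v w = 0 -> v = w.
Proof. by move/eqP/nilP=> e; rewrite -(geo_last v w) e. Qed.

Lemma dist_gt0 v w : v <> w -> (0 < dist v w)%N.
Proof. by move=> vw; rewrite lt0n; apply/eqP => /dist0. Qed.

Lemma dist_sym v w : dist v w = dist w v.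
Proof.
suff le a b : (dist a b <= dist b a)%N by apply/eqP; rewrite eqn_leq !le.
have := rev_path (@adj T) b (geo b a); rewrite geo_last.
rewrite (eq_path (e' := @adj T)); last by move=> s t; rewrite adj_sym.
rewrite geo_path => /dist_path; rewrite size_rev size_belast -/(dist b a).
case: (geo b a) (geo_last b a) => [/= <-|x p _]; first by rewrite distxx.
by rewrite /= rev_cons last_rcons.
Qed.

Lemma dist_tri w v x : (dist v x <= dist v w + dist w x)%N.
Proof.
have: path (@adj T) v (geo v w ++ geo w x) by rewrite cat_path geo_last !geo_path.
by move/dist_path; rewrite last_cat !geo_last size_cat.
Qed.

Lemma dist_adj v w : adj v w -> dist v w = 1%N.
Proof.
move=> vw; apply/eqP; rewrite eqn_leq dist_gt0 ?andbT.
  by apply: (@dist_path v [:: w]); rewrite /= vw.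
by move=> e; rewrite e adj_irr in vw.
Qed.

Lemma dist_homo (f : T -> T) :
  {homo f : v w / adj v w} -> forall v w, (dist (f v) (f w) <= dist v w)%N.
Proof.
move=> fadj v w.
have := @homo_path _ _ f (@adj T) (@adj T) v (geo v w) fadj (geo_path v w).
by move/dist_path; rewrite last_map geo_last size_map.
Qed.

Definition btw a x b := dist a x + dist x b == dist a b.

Lemma btw_sym a x b : btw a x b = btw b x a.
Proof. by rewrite /btw (dist_sym a x) (dist_sym x b) (dist_sym a b) addnC. Qed.

Lemma geo_cat a x b : btw a x b -> geo a b = geo a x ++ geo x b.
Proof.
move/eqP=> e.
have pP: path (@adj T) a (geo a x ++ geo x b) by rewrite cat_path geo_last !geo_path.
rewrite -(dist_path_geo pP); first by rewrite last_cat !geo_last.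
by rewrite size_cat last_cat !geo_last; apply/eq_leq.
Qed.

Lemma mem_geo a x b : (x \in a :: geo a b) = btw a x b.
Proof.
apply/idP/idP => [xg|bx]; last first.
  by rewrite (geo_cat bx) -cat_cons mem_cat -{1}(geo_last a x) mem_last.
have [p1 [p2 [e e1]]] : exists p1 p2, geo a b = p1 ++ p2 /\ last a p1 = x.
  by case/splitPl: xg => p1 p2 e1; exists p1, p2.
have := geoP a b; rewrite /spath e cat_path e1 last_cat e1 -cat_cons cat_uniq.
case=> /andP[P1 P2] l2 /and3P[u1 n2 u2].
rewrite /btw [dist a b]/dist e size_cat /dist (geoE (p := p1)) // (geoE (p := p2)) //.
split=> //=; rewrite u2 andbT; apply: contra n2 => xp2; apply/hasP; exists x => //=.
by rewrite -e1 mem_last.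
Qed.

(** [geo a x] and [geo a y] are prefixes of equal length of the same [geo a b]. *)
Lemma btw_uniq a b x y : btw a x b -> btw a y b -> dist a x = dist a y -> x = y.
Proof.
move=> /geo_cat gx /geo_cat gy e.
rewrite -(geo_last a x) -(geo_last a y); congr last.
have := congr1 (take (dist a x)) (etrans (esym gx) gy).
by rewrite take_size_cat // e take_size_cat.
Qed.

Lemma btw_cmp a b x y : btw a x b -> btw a y b -> btw a y x || btw x y b.
Proof.
move=> bx; rewrite -!mem_geo (geo_cat bx) -cat_cons mem_cat => /orP[->//|h].
by rewrite [y \in x :: _]in_cons h !orbT.
Qed.

Definition convex C := forall a b x, C a -> C b -> btw a x b -> C x.

Definition nearest C v (p : T) := C p /\ forall c, C c -> (dist v p <= dist v c)%N.

Lemma nearest_exists C v c : C c -> exists p : T, nearest C v p.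
Proof. by move=> Cc; have [p Cp minp] := exists_argmin (dist v) Cc; exists p. Qed.

(** The geodesics from [v] to [p] and from [p] to [c] meet only in [p]: another common vertex would
    lie in [C] by convexity and be nearer to [v]. *)
Lemma nearest_btw C v (p : T) c : convex C -> nearest C v p -> C c -> btw v p c.
Proof.
move=> cvC [Cp minp] Cc; apply/eqP; rewrite -size_cat /dist; congr size.
apply/esym/geoE; split; first by rewrite cat_path geo_last !geo_path.
  by rewrite last_cat !geo_last.
have /andP[np up] : (p \notin geo p c) && uniq (geo p c) := geo_uniq p c.
rewrite -cat_cons cat_uniq geo_uniq up andbT; apply/hasPn => y yg.
rewrite mem_geo; apply/negP => /eqP vyp.
have byc : btw p y c by rewrite -mem_geo inE yg orbT.
have /minp : C y by apply: cvC byc.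
case: (y =P p) yg np => [-> -> //|/dist_gt0]; lia.
Qed.

Lemma convex_btw a b : convex (fun x => btw a x b).
Proof.
move=> x y z bx bz; have := btw_cmp bx bz.
move: bx bz; rewrite /btw => /eqP bx /eqP bz /orP[] /eqP h /eqP h'; apply/eqP;
  have := dist_tri z a b; have := dist_tri x a z; have := dist_tri y a z;
  have := dist_tri x z b; have := dist_tri y z b;
  have := dist_sym x y; have := dist_sym z x; have := dist_sym z y; lia.
Qed.

(** The projection of [c] to the geodesic from [a] to [b] is such a vertex. *)
Lemma median_exists a b c : exists m, [/\ btw a m b, btw a m c & btw b m c].
Proof.
have aab : btw a a b by rewrite /btw distxx.
have bab : btw a b b by rewrite /btw distxx addn0.
have [m nm] := @nearest_exists (fun x => btw a x b) c a aab.
exists m; split; first by case: nm.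
  by rewrite btw_sym; apply: (nearest_btw (@convex_btw a b) nm).
by rewrite btw_sym; apply: (nearest_btw (@convex_btw a b) nm).
Qed.

Definition isometry_of (f : T -> T) := forall v w, dist (f v) (f w) = dist v w.

Lemma btw_iso f a x b : isometry_of f -> btw (f a) (f x) (f b) = btw a x b.
Proof. by move=> fi; rewrite /btw !fi. Qed.

Lemma convex_fix f : isometry_of f -> convex (fun x => f x = x).
Proof.
move=> fi a b x fa fb bx; apply: (@btw_uniq a b) => //.
  by rewrite -fa -fb btw_iso.
by rewrite -{1}fa fi.
Qed.

(* The median of an orbit of three points is fixed. *)
Lemma fix_order3 f : isometry_of f -> (forall x, f (f (f x)) = x) ->
  exists v, f v = v.
Proof.
move=> fi f3; have [x] : inhabited T by case: (T).
have [m [m1 m2 m3]] := median_exists x (f x) (f (f x)); exists m.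
have := m1; have := m2; have := m3.
rewrite -(btw_iso _ _ _ fi) -(btw_iso x _ _ fi) -(btw_iso x m (f x) fi) !f3.
move=> n2 n3 n1.
apply: (@btw_uniq x (f x)) => //; first by rewrite btw_sym.
move: m1 m2 m3 n1 n2 n3; rewrite /btw !fi.
have := dist_sym (f m) x; have := dist_sym (f (f x)) x.
have := fi (f (f x)) x; have := fi x (f x).
have := fi (f x) (f (f x)).
have := fi x m; have := fi (f x) m; have := fi (f (f x)) m.
have := fi m x; have := fi m (f x); have := fi m (f (f x)).
have := dist_sym m x; have := dist_sym m (f x); have := dist_sym m (f (f x)).
rewrite !f3; lia.
Qed.

(** The median of [y], [f y] and [p] is fixed, because [f] maps the geodesic from [p] to [y] onto
    the one from [p] to [f y]; minimality then makes it equal to [p]. *)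
Lemma nearest_fix_mid f y (p : T) : isometry_of f -> nearest (fun x => f x = x) y p ->
  btw y p (f y) /\ dist y p = dist p (f y).
Proof.
move=> fi np; have [fp minp] := np.
have e : dist p (f y) = dist p y by rewrite -{1}fp fi.
split; last by rewrite e dist_sym.
have [m [m1 m2 m3]] := median_exists y (f y) p.
suff fm : f m = m.
  have := minp _ fm; move: m2 => /eqP m2.
  case: (m =P p) => [<- //|/dist_gt0]; lia.
apply: (@btw_uniq p (f y)); last by rewrite -{1}fp fi.
  by rewrite -{1}fp btw_iso // btw_sym.
by rewrite btw_sym.
Qed.

(* The common fixed vertex is the midpoint of the geodesic from [y] to [f y]. *)
Lemma common_fix f g y a b : isometry_of f -> isometry_of g ->
  f a = a -> g b = b -> f y = g y -> exists v, f v = v /\ g v = v.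
Proof.
move=> fi gi fa gb e.
have [p np] := @nearest_exists (fun x => f x = x) y a fa.
have [q nq] := @nearest_exists (fun x => g x = x) y b gb.
have [bp ep] := nearest_fix_mid fi np; have [bq eq] := nearest_fix_mid gi nq.
exists p; split; first by case: np.
suff -> : p = q by case: nq.
apply: (@btw_uniq y (f y)) => //; first by rewrite e.
by move: bp bq eq; rewrite /btw -e; lia.
Qed.

(* If [p] is the projection of [v] to the fixed tree of [f], then
   [dist v (g v)] exceeds [dist p (g p)] by twice the distance from [v] to [p]. *)
Lemma fix_of_commuting f g v a : isometry_of f -> isometry_of g ->
  (forall x, exists y, g y = x) -> (forall x, f (g x) = g (f x)) ->
  f a = a -> (forall x, g x <> x) ->
  (forall x, dist v (g v) <= dist x (g x))%N -> f v = v.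
Proof.
move=> fi gi gsurj fg fa nofix minv; pose C x := f x = x.
have cvC : convex C by apply: convex_fix.
have [p np] := @nearest_exists C v a fa; have [fp minp] := np.
(* As [g] commutes with [f], it permutes the fixed set of [f] and carries the projection of [v] to
   that of [g v]. *)
have ng : nearest C (g v) (g p).
  split=> [|c fc]; first by rewrite /C fg fp.
  have [c' gc'] := gsurj c; rewrite -gc' !gi; apply: minp; apply: dist0.
  by rewrite -gi -fg gc' fc distxx.
have /eqP vgp := nearest_btw cvC np (proj1 ng).
have bgp := nearest_btw cvC ng fp.
suff h : (2 * dist v p + dist p (g p) <= dist v (g v))%N.
  case: (v =P p) => [-> //|/dist_gt0]; have := minv p; lia.
have [m [/eqP m1 /eqP m2 m3]] := median_exists v (g v) p.
have := gi v p; have := dist_sym (g v) m; have := dist_sym (g p) p.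
(* The median cannot precede [g p] on the geodesic from [g v] to [p]; between [g p] and [p] it is
   fixed by [f], so minimality forces [m = p]. *)
have /orP[|] := btw_cmp bgp m3; move: bgp m3 => /eqP bgp /eqP m3.
  move=> /eqP bm; have := dist_tri m v (g p).
  have := dist_gt0 (nofix p); lia.
move=> bm; have /minp := cvC _ _ _ (proj1 ng) fp bm; lia.
Qed.
End TreeMetric.

(** * Automorphisms of products of trees *)

Lemma inj_iter_id (I : finType) (f : I -> I) : injective f ->
  exists2 k, (0 < k)%N & forall i, iter k f i = i.
Proof.
move=> fi; exists (\prod_i order f i)%N.
  by rewrite prodn_gt0 // => i; apply: order_gt0.
move=> i; rewrite (bigD1 i) //= mulnC.
by elim: (\prod_(_ | _) _)%N => //= m IHm; rewrite mulSn iterD IHm iter_order.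
Qed.

Section ProductAut.
Variables (n : nat) (T : 'I_n -> tree).
Implicit Types (x y z w : vertices T) (i j k l : 'I_n).

Definition upd x i (v : T i) : vertices T := @dfwith _ (fun j => T j) x i v.

Lemma upd_in x i (v : T i) : upd x v i = v.
Proof. exact: dfwith_in. Qed.

Lemma upd_out x i (v : T i) j : j != i -> upd x v j = x j.
Proof. by rewrite eq_sym; apply: dfwith_out. Qed.

Lemma vertices_ext x y : (forall i, x i = y i) -> x = y.
Proof. exact: functional_extensionality_dep. Qed.

Definition padj i x y := adj (x i) (y i) /\ forall j, j != i -> x j = y j.

Lemma padj_sym i x y : padj i x y -> padj i y x.
Proof. by case=> a e; split=> [|j /e //]; rewrite adj_sym. Qed.

Lemma padj_neq i x y : padj i x y -> x i <> y i.
Proof. by case=> a _ e; rewrite e adj_irr in a. Qed.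

Lemma padj_dir i j x y : padj i x y -> padj j x y -> i = j.
Proof.
move=> a [_ e]; apply/eqP; apply: contra_notT (padj_neq a) => ij; exact: e.
Qed.

Lemma padj_upd x i (v w : T i) : adj v w -> padj i (upd x v) (upd x w).
Proof. by move=> vw; split=> [|j ji]; rewrite ?upd_in // !upd_out. Qed.

Lemma padj_updr i x y : adj (x i) (y i) -> padj i x (upd x (y i)).
Proof. by move=> a; split=> [|j ji]; rewrite ?upd_in // upd_out. Qed.

(** If two coordinates differed, changing only one of them would give a third vertex of the cube.
    Thus automorphisms, defined through cubes, preserve edges. *)
Lemma edge_cubeP x y : x <> y ->
  cubes T [set x; y] <-> exists i, padj i x y.
Proof.
move=> nxy; split=> [[s [ss e]]|[i [a xy]]]; last first.
  exists (fun j => [set x j; y j]); split.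
    move=> j; have [->|ji] := eqVneq j i; first by right; exists (x i), (y i).
    by left; exists (x j); rewrite -(xy j ji) setUid.
  rewrite eqEsubset; split=> [z [->|->] j|z /= h]; [by left|by right|].
  case: (h i) => zi; [left|right]; apply: vertices_ext => j.
    have [->//|ji] := eqVneq j i; by case: (h j) => ->; rewrite ?(xy j ji).
  have [->//|ji] := eqVneq j i; by case: (h j) => ->; rewrite ?(xy j ji).
have sx : forall j, s j (x j) by have: [set x; y] x := or_introl erefl; rewrite e.
have sy : forall j, s j (y j) by have: [set x; y] y := or_intror erefl; rewrite e.
have [i xyi] : exists i, x i <> y i.
  by apply/existsNP => h; apply: nxy; apply: vertices_ext.
exists i; split.
  case: (ss i) => [[v es]|[v [w [vw es]]]].
    by case: xyi; move: (sx i) (sy i); rewrite es => -> ->.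
  move: (sx i) (sy i) xyi; rewrite es => -[->|->] [->|->] // _.
  by rewrite adj_sym.
move=> j ji; have: [set x; y] (upd x (y i)).
  rewrite e => k; have [->|ki] := eqVneq k i; first by rewrite upd_in.
  by rewrite upd_out.
case=> h; last by rewrite -h upd_out.
by case: xyi; rewrite -{1}h upd_in.
Qed.

Lemma aut_padj (f : aut (cubes T)) i x y :
  padj i x y -> exists k, padj k (f x) (f y).
Proof.
move=> a; have nxy : x <> y by move=> e; apply: (padj_neq a); rewrite e.
apply/edge_cubeP.
  by move=> /(congr1 (val f)^-1); rewrite !symVK.
have /asboolP fC : val f \in is_aut (cubes T) by apply: valP.
have := fC [set x; y]; rewrite image_setU !image_set1 => ->.
by apply/edge_cubeP => //; exists i.
Qed.

Lemma autVK (f : aut (cubes T)) x : f^-1 (f x) = x.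
Proof. exact: symVK. Qed.

Lemma autKV (f : aut (cubes T)) x : f (f^-1 x) = x.
Proof. exact: symKV. Qed.

Lemma autM (f g : aut (cubes T)) x : (f * g) x = f (g x).
Proof. by []. Qed.

Lemma square_fill i j x y z : padj i x y -> padj j x z -> i != j ->
  exists w, [/\ padj j y w, padj i z w & w <> x].
Proof.
move=> xy xz ij; have [axy exy] := xy; have [axz exz] := xz.
exists (upd y (z j)); split; first by apply: padj_updr; rewrite -exy // eq_sym.
  split; first by rewrite upd_out // -exz.
  move=> k ki; have [->|kj] := eqVneq k j; first by rewrite upd_in.
  by rewrite upd_out // -exy // exz.
by move=> e; apply: (padj_neq xz); rewrite -e upd_in.
Qed.

(** Two parallel edges at [x] span no square: all four vertices would differ in the coordinate [i]
    only and form a cycle in [T i]. *)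
Lemma no_square i k l x y z w : padj i x y -> padj i x z -> y <> z ->
  padj k y w -> padj l z w -> w = x.
Proof.
move=> xy xz nyz yw zw; have [axy exy] := xy; have [axz exz] := xz.
have [ayw eyw] := yw; have [azw ezw] := zw.
have eyz j : j != i -> y j = z j by move=> ji; rewrite -exy // exz.
have nyzi : y i <> z i.
  move=> e; apply: nyz; apply: vertices_ext => j.
  by have [->//|] := eqVneq j i; apply: eyz.
have ki : k = i.
  apply/eqP; apply: contra_notT (padj_neq yw) => ki.
  have wi : w i = y i by rewrite -eyw // eq_sym.
  have li : l = i.
    by apply/eqP; apply: contra_notT nyzi => li; rewrite ezw ?wi // eq_sym.
  by rewrite eyz // ezw // li.
have li : l = i.
  apply/eqP; apply: contra_notT (padj_neq zw) => li.
  by rewrite -eyz // eyw // ki.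
subst k l; apply: vertices_ext => j.
have [->|ji] := eqVneq j i; last by rewrite -eyw // exy.
apply/eqP; apply: contraT => nwx.
have : ucycle (@adj (T i)) [:: x i; y i; w i; z i].
  rewrite /ucycle /= axy ayw (adj_sym (w i)) azw (adj_sym (z i)) axz /=.
  rewrite !inE !negb_or (eq_sym (x i) (w i)) nwx !andbT /=.
  have neq (a b : T i) : adj a b -> a != b.
    by move=> ab; apply/eqP => e; rewrite e adj_irr in ab.
  rewrite (neq _ _ axy) (neq _ _ axz) (neq _ _ ayw) /=.
  by rewrite (eq_sym (w i)) (neq _ _ azw) !andbT; apply/eqP.
by move/tree_acyclic.
Qed.

Lemma square_opposite i j k l x y z w : padj i x y -> padj j x z -> i != j ->
  padj k y w -> padj l z w -> w <> x -> k = j /\ l = i.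
Proof.
move=> xy xz ij yw zw nwx; have [axy exy] := xy; have [axz exz] := xz.
have [ayw eyw] := yw; have [azw ezw] := zw.
have ji : j != i by rewrite eq_sym.
have nk m : m != k -> m != l -> y m = z m by move=> mk ml; rewrite eyw // ezw.
have hi : k = i \/ l = i.
  have [->|ki] := eqVneq k i; first by left.
  have [->|li] := eqVneq l i; first by right.
  by case: (padj_neq xy); rewrite exz // nk // eq_sym.
have hj : k = j \/ l = j.
  have [->|kj] := eqVneq k j; first by left.
  have [->|lj] := eqVneq l j; first by right.
  by case: (padj_neq xz); rewrite exy // nk // eq_sym.
case: hi hj => [hi|hi] [hj|hj]; [by rewrite -hi hj eqxx in ij| |by []|].
  subst k l; case: nwx; apply: vertices_ext => m.
  have [->|mi] := eqVneq m i; first by rewrite -ezw // exz.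
  by rewrite -eyw // exy.
by rewrite -hi hj eqxx in ij.
Qed.

(** If the images had different directions they would span a square, whose preimage is excluded by
    [no_square]. *)
Lemma aut_dir_eq (f : aut (cubes T)) i j k l x y z :
  padj i x y -> padj j x z -> padj k (f x) (f y) -> padj l (f x) (f z) ->
  i = j -> k = l.
Proof.
move=> xy xz fxy fxz ij; subst j; apply/eqP; apply: contraT => kl.
have [eyz|nyz] := pselect (y = z).
  by rewrite eyz in fxy; rewrite (padj_dir fxy fxz) eqxx in kl.
have [w [yw zw nw]] := square_fill fxy fxz kl.
have [k' yw'] := aut_padj f^-1 yw; have [l' zw'] := aut_padj f^-1 zw.
rewrite !autVK in yw' zw'.
by case: nw; rewrite -(no_square xy xz nyz yw' zw') autKV.
Qed.

Lemma aut_dir_neq (f : aut (cubes T)) i j k l x y z :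
  padj i x y -> padj j x z -> padj k (f x) (f y) -> padj l (f x) (f z) ->
  k = l -> i = j.
Proof.
move=> xy xz fxy fxz; apply: (@aut_dir_eq f^-1 _ _ _ _ _ _ _ fxy fxz).
  by rewrite !autVK.
by rewrite !autVK.
Qed.

(** Induction along the edges whose direction lies in [A]; the coordinates are corrected one factor
    at a time. *)
Lemma conn_ind (A : pred 'I_n) (P : vertices T -> Prop) :
  (forall x y j, A j -> padj j x y -> P x -> P y) ->
  forall x y, (forall j, ~~ A j -> x j = y j) -> P x -> P y.
Proof.
move=> stepP x y exy.
suff h : forall (s : seq 'I_n), all A s -> forall x,
    (forall j, j \notin s -> x j = y j) -> P x -> P y.
  apply: (h (enum A)) => [|j]; first by apply/allP => j; rewrite mem_enum.
  by rewrite mem_enum; apply: exy.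
elim=> [_ {}x {}exy|i s IHs /= /andP[Ai As] {}x {}exy Px].
  by rewrite (vertices_ext (fun j => exy j isT)).
apply: (IHs As (upd x (y i))).
  move=> j js; have [->|ji] := eqVneq j i; first by rewrite upd_in.
  by rewrite upd_out // exy // inE negb_or ji.
have [p pP <-] := tree_connected (x i) (y i).
have: P (upd x (x i)).
  rewrite (_ : upd _ _ = x) //; apply: vertices_ext => j.
  by have [->|ji] := eqVneq j i; rewrite ?upd_in // upd_out.
elim: p (x i) pP => [//|v p IHp u /= /andP[uv pP] Pu].
by apply: (IHp _ pP); apply: (stepP _ _ i Ai (padj_upd x uv) Pu).
Qed.

(** For [i != j] the edges span a square. Its image is again a square, whose opposite sides are
    parallel. *)
Lemma aut_dir_step (f : aut (cubes T)) i j k l x y x' y' :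
  padj i x y -> padj j x x' -> padj i x' y' ->
  padj k (f x) (f y) -> padj l (f x') (f y') -> k = l.
Proof.
move=> xy xx' xy' fxy fxy'; have [m fxx'] := aut_padj f xx'.
have [ij|ij] := eqVneq i j.
  rewrite (aut_dir_eq xy xx' fxy fxx' ij).
  apply: (aut_dir_eq (padj_sym xx') xy' (padj_sym fxx') fxy'); by rewrite ij.
have [w [yw xw nw]] := square_fill xy xx' ij.
have [p fyw] := aut_padj f yw; have [q fxw] := aut_padj f xw.
have km : k != m.
  by apply/eqP => /(aut_dir_neq xy xx' fxy fxx') e; rewrite e eqxx in ij.
have nfw : f w <> f x by move=> /(congr1 f^-1); rewrite !autVK.
have [_ <-] := square_opposite fxy fxx' km fyw fxw nfw.
exact: (aut_dir_eq xw xy' fxw fxy').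
Qed.

Lemma nbr_exists i x y z : padj i x y -> exists w, padj i z w.
Proof.
move=> xy; apply: (@conn_ind predT (fun z => exists w, padj i z w) _ x) => //.
  move=> u v j _ uv [w uw]; have [ij|ij] := eqVneq i j.
    by exists u; rewrite ij; apply: padj_sym.
  by have [t []] := square_fill uw uv ij; exists t.
by exists y.
Qed.

Lemma aut_dir (f : aut (cubes T)) i k l x y x' y' :
  padj i x y -> padj i x' y' ->
  padj k (f x) (f y) -> padj l (f x') (f y') -> k = l.
Proof.
move=> xy xy' fxy; move: x' y' l xy'.
suff: forall x', (forall y' l, padj i x' y' -> padj l (f x') (f y') -> k = l).
  by move=> h x' y' l; apply: h.
move=> x'; apply: (@conn_ind predT (fun x' => forall y' l, padj i x' y' ->
  padj l (f x') (f y') -> k = l) _ x) => //.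
  move=> u v j _ uv hu y' l vy' fvy'.
  have [w uw] := nbr_exists u xy; have [m fuw] := aut_padj f uw.
  by rewrite (hu w m) //; apply: (aut_dir_step uw uv vy' fuw fvy').
by move=> y' l xy' fxy'; apply: (aut_dir_eq xy xy' fxy fxy' erefl).
Qed.

(* A one-vertex factor spans no edge, hence the default value. *)
Definition aut_perm_fun (f : aut (cubes T)) i : 'I_n :=
  xget i [set k | exists x y, padj i x y /\ padj k (f x) (f y)]%classic.

Lemma aut_perm_funP f i x y : padj i x y -> padj (aut_perm_fun f i) (f x) (f y).
Proof.
move=> xy; have [k fxy] := aut_padj f xy.
rewrite /aut_perm_fun; case: xgetP => [_ -> [x' [y' [xy' fxy']]]|/(_ k) []].
  by rewrite -(aut_dir xy xy' fxy fxy').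
by exists x, y.
Qed.

Lemma aut_perm_fun_out f i : (forall x y, ~ padj i x y) -> aut_perm_fun f i = i.
Proof.
by move=> no; rewrite /aut_perm_fun; case: xgetP => // k -> [x [y [/no]]].
Qed.

Lemma has_padj i : (exists x y, padj i x y) \/ forall x y, ~ padj i x y.
Proof.
have [h|h] := pselect (exists x y, padj i x y); first by left.
by right=> x y xy; apply: h; exists x, y.
Qed.

(** Two directions that contain edges are compared at a common vertex; a direction without edges is
    fixed and is never the image of one with edges. *)
Lemma aut_perm_fun_inj f : injective (aut_perm_fun f).
Proof.
have no_img i j : (exists x y, padj i x y) -> (forall x y, ~ padj j x y) ->
    aut_perm_fun f i <> j.
  by move=> [x [y xy]] no e; have := aut_perm_funP f xy; rewrite e => /no.
move=> i j e.
case: (has_padj i) (has_padj j) => [pi|npi] [pj|npj].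
- have [x [y xy]] := pi; have [x' [z' xz']] := pj; have [z xz] := nbr_exists x xz'.
  by apply: (aut_dir_neq xy xz (aut_perm_funP f xy) (aut_perm_funP f xz)).
- by case: (no_img _ _ pi npj); rewrite e aut_perm_fun_out.
- by case: (no_img _ _ pj npi); rewrite -e aut_perm_fun_out.
- by rewrite aut_perm_fun_out in e => //; rewrite aut_perm_fun_out in e.
Qed.

Lemma aut_perm_funM f g i :
  aut_perm_fun (f * g) i = aut_perm_fun f (aut_perm_fun g i).
Proof.
case: (has_padj i) => [[x [y xy]]|no]; last by rewrite !(aut_perm_fun_out _ no).
have a := aut_perm_funP (f * g) xy.
exact: padj_dir a (aut_perm_funP f (aut_perm_funP g xy)).
Qed.

Definition pure (f : aut (cubes T)) := forall i, aut_perm_fun f i = i.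

Lemma pureM f g : pure f -> pure g -> pure (f * g).
Proof. by move=> pf pg i; rewrite aut_perm_funM pg pf. Qed.

Lemma pure1 : pure 1.
Proof.
move=> i; apply: (@aut_perm_fun_inj 1); rewrite -aut_perm_funM.
by rewrite mulg1.
Qed.

Lemma pureV f : pure f -> pure f^-1.
Proof. by move=> pf i; rewrite -[RHS]pure1 -(mulgV f) aut_perm_funM pf. Qed.

Lemma pure_padj f i x y : pure f -> padj i x y -> padj i (f x) (f y).
Proof. by move=> pf /(aut_perm_funP f); rewrite pf. Qed.

(** Moving along an edge in another direction moves the image in that other direction. Hence a pure
    automorphism induces a map on each factor. *)
Lemma pure_coord f i x y : pure f -> x i = y i -> f x i = f y i.
Proof.
move=> pf xy; apply: (@conn_ind (predC1 i) (fun y => f x i = f y i) _ x) => //.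
  move=> u v j /= ji uv ->; have [_ -> //] := pure_padj pf uv.
  by rewrite eq_sym.
by move=> j /=; rewrite negbK => /eqP ->.
Qed.

Lemma pureX f (k : nat) : pure f -> pure (f ^+ k).
Proof.
move=> pf; elim: k => [|k IHk]; first exact: pure1.
by rewrite expgS; apply: pureM.
Qed.

Lemma pure_power f : exists2 k, (0 < k)%N & pure (f ^+ k).
Proof.
have [k k0 fk] := inj_iter_id (@aut_perm_fun_inj f); exists k => // i.
rewrite -[RHS]fk; elim: k {k0 fk} => [|k IHk]; first exact: pure1.
by rewrite expgS aut_perm_funM IHk.
Qed.
End ProductAut.

Ltac eval_neq := repeat match goal with
  | H : is_true (?a != ?b) |- context [?a == ?b] => rewrite (negbTE H) /=
  | |- context [?a == ?a] => rewrite eqxx /= end.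

(** * Three-cycles and shifts in the Houghton group *)

Section Transpositions.
Variable X : choiceType.
Implicit Types (a b c x y : X) (f g : sym X).

Definition tr_fun a b x := if x == a then b else if x == b then a else x.

Lemma tr_funK a b : involutive (tr_fun a b).
Proof.
move=> x; rewrite /tr_fun; have [->|xa] := eqVneq x a.
  by rewrite eqxx; case: eqVneq.
have [->|xb] := eqVneq x b; first by rewrite eqxx.
by rewrite (negbTE xa) (negbTE xb).
Qed.

Definition tr a b : sym X := Sym (inv_bij (@tr_funK a b)).

Lemma trE a b x : tr a b x = if x == a then b else if x == b then a else x.
Proof. by []. Qed.

Lemma trl a b : tr a b a = b. Proof. by rewrite trE eqxx. Qed.

Lemma trr a b : tr a b b = a.
Proof. by rewrite trE eqxx; case: eqVneq. Qed.

Lemma trD a b x : x != a -> x != b -> tr a b x = x.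
Proof. by rewrite trE => /negbTE -> /negbTE ->. Qed.

Lemma tr_sym a b : tr a b = tr b a.
Proof.
by apply: sym_ext => x; rewrite !trE; case: (eqVneq x a) => [->|]; case: eqVneq.
Qed.

Lemma tr2 a b : tr a b * tr a b = 1.
Proof. by apply: sym_ext => x; apply: tr_funK. Qed.

Lemma sym_inj f : injective f.
Proof. exact: bij_inj (sym_bij f). Qed.

Lemma sym_eq f x y : (f x == f y) = (x == y).
Proof. exact: inj_eq (@sym_inj f) _ _. Qed.

Lemma trJ f a b : f * tr a b * f^-1 = tr (f a) (f b).
Proof.
apply: sym_ext => x; rewrite -{1 2}(symKV f x) !symME symVK !trE !sym_eq.
by case: eqP => // _; case: eqP.
Qed.
End Transpositions.

Lemma fresh (X : eqType) (ys : nat -> X) (s : seq X) : injective ys ->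
  exists k, ys k \notin s.
Proof.
move=> ysi; apply: contrapT => /forallNP h.
have: (size (map ys (iota 0 (size s).+1)) <= size s)%N.
  apply: uniq_leq_size; first by rewrite map_inj_uniq ?iota_uniq.
  by move=> x /mapP[k _ ->]; have /negP := h k; rewrite negbK.
by rewrite size_map size_iota ltnn.
Qed.

Section Houghton.
Let X := ('I_3 * nat)%type.
Implicit Types (f g : houghton 3) (a b c x y : X).

Definition hou (f : sym X) (ft : eventually_translation f) : houghton 3 :=
  Houghton (asboolT ft).

Lemma houghton_ext f g : (forall x, f x = g x) -> f = g.
Proof. by move=> fg; apply/val_inj/sym_ext. Qed.

Lemma hM f g x : (f * g) x = f (g x). Proof. by []. Qed.
Lemma h1 x : (1 : houghton 3) x = x. Proof. by []. Qed.
Lemma hVK f x : f^-1 (f x) = x. Proof. exact: (symVK (val f)). Qed.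
Lemma hKV f x : f (f^-1 x) = x. Proof. exact: (symKV (val f)). Qed.
Lemma h_inj f : injective f. Proof. exact: sym_inj. Qed.

Lemma tr_ev a b : eventually_translation (tr a b).
Proof.
exists (fun=> 0%R) => i; exists (a.2 + b.2).+1 => m le_m.
rewrite trD; first by rewrite addr0.
  by apply: contraTneq le_m => <- /=; lia.
by apply: contraTneq le_m => <- /=; lia.
Qed.

Definition htr a b := hou (tr_ev a b).
(* Locked, so that rewriting with [hM] does not split it into its factors. *)
Definition cyc : X -> X -> X -> houghton 3 :=
  locked (fun a b c => htr a b * htr b c).

Lemma htrJ f a b : f * htr a b * f^-1 = htr (f a) (f b).
Proof. by apply/val_inj; apply: (trJ (val f)). Qed.

Lemma cycJ f a b c : f * cyc a b c * f^-1 = cyc (f a) (f b) (f c).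
Proof. by rewrite /cyc -!lock -!htrJ !mulgA mulgVK. Qed.

Lemma cycE a b c x : a != b -> b != c -> a != c ->
  cyc a b c x = if x == a then b else if x == b then c else if x == c then a else x.
Proof.
move=> ab bc ac; rewrite /cyc -lock hM /= /tr_fun.
have [->|xb] := eqVneq x b.
  by rewrite (eq_sym b a) (negbTE ab) (eq_sym c a) (negbTE ac) eq_sym (negbTE bc).
have [->|xc] := eqVneq x c.
  by rewrite (eq_sym c a) (negbTE ac) eqxx eq_sym (negbTE ab).
by rewrite (negbTE xb).
Qed.

Lemma cyc_rot a b c : a != b -> b != c -> a != c -> cyc a b c = cyc b c a.
Proof.
move=> ab bc ac; apply: houghton_ext => x; rewrite !cycE // 1?eq_sym //.
have [->|xa] := eqVneq x a; last by [].
by rewrite (negbTE ab) (negbTE ac).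
Qed.

Lemma cyc3 a b c : a != b -> b != c -> a != c -> cyc a b c * (cyc a b c * cyc a b c) = 1.
Proof.
move=> ab bc ac; apply: houghton_ext => x.
have ba : b != a by rewrite eq_sym. have cb : c != b by rewrite eq_sym.
have ca : c != a by rewrite eq_sym.
rewrite !hM h1 [cyc a b c x]cycE //.
have [->|xa] := eqVneq x a; first by rewrite !cycE //; eval_neq.
have [->|xb] := eqVneq x b; first by rewrite !cycE //; eval_neq.
have [->|xc] := eqVneq x c; first by rewrite !cycE //; eval_neq.
by rewrite !cycE //; eval_neq.
Qed.

Lemma cyc_div a b c d : uniq [:: a; b; c; d] ->
  (cyc a b c)^-1 * cyc a b d = cyc b d c.
Proof.
rewrite /= !inE !negb_or => /and4P[/and3P[ab ac ad] /andP[bc bd] cd _].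
have [ba ca da] : [/\ b != a, c != a & d != a] by rewrite !(eq_sym _ a).
have [cb db dc] : [/\ c != b, d != b & d != c] by rewrite !(eq_sym _ b) (eq_sym d).
apply: (mulgI (cyc a b c)); rewrite mulVKg; apply: houghton_ext => x.
rewrite hM [cyc a b d x]cycE // [cyc b d c x]cycE //.
have [->|xb] := eqVneq x b; first by rewrite cycE //; eval_neq.
have [->|xd] := eqVneq x d; first by rewrite cycE //; eval_neq.
have [->|xc] := eqVneq x c; first by rewrite cycE //; eval_neq.
have [->|xa] := eqVneq x a; first by rewrite cycE //; eval_neq.
by rewrite cycE //; eval_neq.
Qed.

(** * Spreading a property from one 3-cycle to all of them *)

Section Spread.
Variables (Y : X -> Prop) (ys : nat -> X).
Hypotheses (ys_inj : injective ys) (Yys : forall k, Y (ys k)).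
Variables (L K : houghton 3 -> Prop).
Hypothesis L_cyc : forall a b c, Y a -> Y b -> Y c ->
  a != b -> b != c -> a != c -> L (cyc a b c).
Hypothesis KJ : forall f k, L f -> K k -> K (f * k * f^-1).

Let Kc a b c := [/\ uniq [:: a; b; c], (Y a /\ Y b) /\ Y c & K (cyc a b c)].

Let Kc_rot a b c : Kc a b c -> Kc b c a.
Proof.
case=> u [[Ya Yb] Yc] k; split => //; first by rewrite -(rot_uniq 1) in u.
by move: u k; rewrite /= !inE !negb_or => /and3P[/andP[ab ac] bc _]; rewrite cyc_rot.
Qed.

(** The conjugator is the 3-cycle on [c], [d] and a fresh fifth point: it sends [c] to [d] and fixes
    [a] and [b]. *)
Let Kc_repl a b c d : Kc a b c -> Y d -> d \notin [:: a; b; c] -> Kc a b d.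
Proof.
case=> u [[Ya Yb] Yc] k Yd nd; have [m] := fresh [:: a; b; c; d] ys_inj.
move: u nd; rewrite /= !inE !negb_or.
move=> /and3P[/andP[ab ac] bc _] /and3P[da db dc] /and4P[ea eb ec ed].
split=> //; first by rewrite /= !inE !negb_or ab (eq_sym a d) da (eq_sym b d) db.
have [cd de ce] : [/\ c != d, d != ys m & c != ys m] by split; rewrite eq_sym.
have [ad bd ae be] : [/\ a != d, b != d, a != ys m & b != ys m].
  by split; rewrite eq_sym.
have cde : L (cyc c d (ys m)) by apply: L_cyc.
by move: (KJ cde k); rewrite cycJ !cycE //; eval_neq.
Qed.

(** One point is replaced at a time. Passing through three fresh points allows the two triples to
    overlap. *)
Lemma spread p q r : uniq [:: p; q; r] -> Y p -> Y q -> Y r -> K (cyc p q r) ->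
  forall a b c, Y a -> Y b -> Y c -> a != b -> b != c -> a != c -> K (cyc a b c).
Proof.
move=> upqr Yp Yq Yr k a b c Ya Yb Yc ab bc ac.
have [u nu] := fresh [:: p; q; r; a; b; c] ys_inj.
have [v nv] := fresh [:: ys u; p; q; r; a; b; c] ys_inj.
have [w nw] := fresh [:: ys v; ys u; p; q; r; a; b; c] ys_inj.
move: (ys u) (ys v) (ys w) (Yys u) (Yys v) (Yys w) nu nv nw => {}u {}v {}w Yu Yv Yw.
rewrite !inE !negb_or => /and5P[up uq ur ua /andP[ub uc]].
move=> /and5P[vu vp vq vr /and3P[va vb vc]].
move=> /and5P[wv wu wp wq /and4P[wr wa wb wc]].
have k1 : Kc p q r by [].
have k2 : Kc p q w by apply: (Kc_repl k1 Yw); rewrite !inE !negb_or wp wq.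
have k3 : Kc q w v.
  by apply: (Kc_repl (Kc_rot k2) Yv); rewrite !inE !negb_or vq vp eq_sym wv.
have k4 : Kc w v u.
  apply: (Kc_repl (Kc_rot k3) Yu).
  by rewrite !inE !negb_or uq (eq_sym u w) wu (eq_sym u v) vu.
have k5 : Kc w v a.
  apply: (Kc_repl k4 Ya).
  by rewrite !inE !negb_or !(eq_sym a) wa va ua.
have k6 : Kc v a b.
  apply: (Kc_repl (Kc_rot k5) Yb).
  by rewrite !inE !negb_or !(eq_sym b) wb vb ab.
have k7 : Kc a b c.
  apply: (Kc_repl (Kc_rot k6) Yc).
  by rewrite !inE !negb_or !(eq_sym c) ac bc vc.
by case: k7.
Qed.

Variables (Q : finType) (phi : houghton 3 -> Q).
Hypothesis phiK : forall f g, L f -> L g -> phi f = phi g -> K (f^-1 * g).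

(* Two of the cycles [cyc y0 y1 yk] have the same image in the finite set [Q],
   and their quotient is again a 3-cycle. *)
Lemma finite_quotient_cyc a b c : Y a -> Y b -> Y c ->
  a != b -> b != c -> a != c -> K (cyc a b c).
Proof.
pose F (k : 'I_#|Q|.+1) := phi (cyc (ys 0) (ys 1) (ys k.+2)).
have [k [l [kl e]]] : exists k l, k != l /\ F k = F l.
  apply: contrapT => h; have : injective F.
    move=> k l e; apply/eqP; apply: contraT => kl; case: h.
    by exists k, l.
  by move=> /leq_card; rewrite card_ord ltnn.
have yE i j : (ys i == ys j) = (i == j) by apply: inj_eq.
apply: (@spread (ys 1) (ys l.+2) (ys k.+2)) => //.
  by rewrite /= !inE !yE !eqSS /= eq_sym (inj_eq val_inj) kl.
rewrite -(@cyc_div (ys 0)); last first.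
  by rewrite /= !inE !yE !eqSS /= (inj_eq val_inj) kl.
by apply: phiK e; apply: L_cyc; rewrite ?yE.
Qed.
End Spread.
End Houghton.

(** * Shifts between two prongs *)

Section Shifts.
Implicit Types (i j k : 'I_3) (x : 'I_3 * nat).

(* The unit translation along the line made of prongs [i] and [j], towards the
   end of prong [j]. *)
Definition shift_fun i j x : 'I_3 * nat :=
  if x.1 == i then (if x.2 is m.+1 then (i, m) else (j, 0))
  else if x.1 == j then (j, x.2.+1) else x.

Lemma shift_funK i j : i != j -> cancel (shift_fun i j) (shift_fun j i).
Proof.
move=> ij [k m]; rewrite /shift_fun /=.
have [->|ki] := eqVneq k i.
  by case: m => [|m] /=; rewrite eqxx // (negbTE ij).
by have [->|kj] := eqVneq k j; rewrite /= ?eqxx ?(negbTE ki) ?(negbTE kj).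
Qed.

Definition shift i j (ij : i != j) : sym ('I_3 * nat) :=
  let ji := etrans (congr1 negb (eq_sym j i)) ij in
  Sym (Bijective (shift_funK ij) (shift_funK ji)).

Lemma shift_ev i j (ij : i != j) : eventually_translation (shift ij).
Proof.
exists (fun k => if k == i then (- 1)%R else if k == j then 1%R else 0%R) => k.
exists 1%N => -[//|m] _; rewrite /= /shift_fun /=.
have [->|ki] := eqVneq k i; first by split=> //=; lia.
by have [->|kj] := eqVneq k j; split=> //=; lia.
Qed.

Definition hshift i j (ij : i != j) := hou (shift_ev ij).

Lemma hshiftX i j (ij : i != j) N x : (hshift ij ^+ N) x =
  if x.1 == i then (if N <= x.2 then (i, x.2 - N) else (j, N.-1 - x.2))%N
  else if x.1 == j then (j, x.2 + N)%N else x.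
Proof.
case: x => k m; elim: N => [|N IHN].
  rewrite expg0 h1 /= subn0 addn0.
  by have [->|_] := eqVneq k i; last by have [->|] := eqVneq k j.
rewrite expgS hM {}IHN /= /shift_fun.
have ji : (j == i) = false by rewrite eq_sym (negbTE ij).
have [_|ki] /= := eqVneq k i.
  have [Nm|mN] /= := leqP N m; last first.
    by rewrite ji eqxx ltnNge (ltnW mN) /=; congr (_, _); lia.
  rewrite eqxx; case: (ltnP N m) => [Nm'|mN].
    by rewrite (_ : m - N = (m - N.+1).+1)%N //; lia.
  by rewrite (_ : m - N = 0)%N //; [congr (_, _)|]; lia.
have [_|kj] /= := eqVneq k j; first by rewrite ji eqxx addnS.
by rewrite (negbTE ki) (negbTE kj).
Qed.
End Shifts.

Definition p0 : 'I_3 := @Ordinal 3 0 isT.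
Definition p1 : 'I_3 := @Ordinal 3 1 isT.
Definition p2 : 'I_3 := @Ordinal 3 2 isT.

Lemma ord3P (k : 'I_3) : [\/ k = p0, k = p1 | k = p2].
Proof.
case: k => [[|[|[|//]]] lt3];
  [apply: Or31|apply: Or32|apply: Or33]; exact: val_inj.
Qed.

Definition tr01 : houghton 3 := @hshift p0 p1 isT.
Definition tr02 : houghton 3 := @hshift p0 p2 isT.

(** * Finitary elements generated by two powers of shifts *)

Section Commutators.
Variable N : nat.
Let s := tr01 ^+ N.
Let u := tr02 ^+ N.

Lemma tr01E0 m : s (p0, m) = if (N <= m)%N then (p0, m - N)%N else (p1, N.-1 - m)%N.
Proof. by rewrite hshiftX. Qed.
Lemma tr01E1 m : s (p1, m) = (p1, m + N)%N. Proof. by rewrite hshiftX. Qed.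
Lemma tr01E2 m : s (p2, m) = (p2, m). Proof. by rewrite hshiftX. Qed.
Lemma tr02E0 m : u (p0, m) = if (N <= m)%N then (p0, m - N)%N else (p2, N.-1 - m)%N.
Proof. by rewrite hshiftX. Qed.
Lemma tr02E1 m : u (p1, m) = (p1, m). Proof. by rewrite hshiftX. Qed.
Lemma tr02E2 m : u (p2, m) = (p2, m + N)%N. Proof. by rewrite hshiftX. Qed.

Lemma tr_divE0 m : (s * u^-1) (p0, m) = (p0, m).
Proof.
have e : u (p0, m + N)%N = (p0, m) by rewrite tr02E0 leq_addl addnK.
by rewrite hM -{1}e hVK tr01E0 leq_addl addnK.
Qed.

(** This commutator exchanges the first [N] points of [p1] and [p2], keeping their order, and fixes
    all other points. *)
Definition swap12 : houghton 3 := locked (s * u * s^-1 * u^-1).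
(** The conjugate exchanges the first [N] points of [p0] and [p2], reversing their order. *)
Definition swap02 : houghton 3 := locked (s^-1 * swap12 * s).

Lemma swap02E x : swap02 x = s^-1 (swap12 (s x)).
Proof. by rewrite /swap02 -lock. Qed.

(** Values of the commutator are computed at points written [u (s x)], which avoids evaluating
    inverses. *)
Let swap12_us x : swap12 (u (s x)) = s (u x).
Proof. by rewrite /swap12 -lock !hM !hVK. Qed.

Lemma swap12_fix k m : (N <= m)%N -> swap12 (k, m) = (k, m).
Proof.
move=> Nm; have [->|->|->] := ord3P k.
- have e : u (s (p0, m + N + N)%N) = (p0, m).
    by rewrite tr01E0 leq_addl addnK tr02E0 leq_addl addnK.
  by rewrite -{1}e swap12_us tr02E0 leq_addl addnK tr01E0 leq_addl addnK.
- have e : u (s (p1, m - N)%N) = (p1, m) by rewrite tr01E1 tr02E1 subnK.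
  by rewrite -{1}e swap12_us tr02E1 tr01E1 subnK.
- have e : u (s (p2, m - N)%N) = (p2, m) by rewrite tr01E2 tr02E2 subnK.
  by rewrite -{1}e swap12_us tr02E2 tr01E2 subnK.
Qed.

Lemma swap12E0 m : swap12 (p0, m) = (p0, m).
Proof.
have e : u (s (p0, m + N + N)%N) = (p0, m).
  by rewrite tr01E0 leq_addl addnK tr02E0 leq_addl addnK.
by rewrite -{1}e swap12_us tr02E0 leq_addl addnK tr01E0 leq_addl addnK.
Qed.

Lemma swap12E1 m : (m < N)%N -> swap12 (p1, m) = (p2, m).
Proof.
move=> mN; have e : u (s (p0, N.-1 - m)%N) = (p1, m).
  by rewrite tr01E0 ifF ?tr02E1; [congr (_, _)|]; lia.
rewrite -{1}e swap12_us tr02E0 ifF ?tr01E2; last by lia.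
by congr (_, _); lia.
Qed.

Lemma swap12E2 m : (m < N)%N -> swap12 (p2, m) = (p1, m).
Proof.
move=> mN; have e : u (s (p0, N + N.-1 - m)%N) = (p2, m).
  by rewrite tr01E0 ifT ?tr02E0 ?ifF; [congr (_, _)| |]; lia.
rewrite -{1}e swap12_us tr02E0 ifT ?tr01E0 ?ifF; try lia.
by congr (_, _); lia.
Qed.

Lemma swap02E0 m : (m < N)%N -> swap02 (p0, m) = (p2, N.-1 - m)%N.
Proof.
move=> mN; rewrite swap02E tr01E0 ifF; last by lia.
rewrite swap12E1; last by lia.
by have := hVK s (p2, N.-1 - m)%N; rewrite tr01E2.
Qed.

Lemma swap02E2 m : (m < N)%N -> swap02 (p2, m) = (p0, N.-1 - m)%N.
Proof.
move=> mN; rewrite swap02E tr01E2 swap12E2 //.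
have -> : (p1, m) = s (p0, N.-1 - m)%N.
  by rewrite tr01E0 ifF; [congr (_, _)|]; lia.
by rewrite hVK.
Qed.

Lemma swap02E1 m : swap02 (p1, m) = (p1, m).
Proof.
rewrite swap02E tr01E1 swap12_fix ?leq_addl //.
by have := hVK s (p1, m); rewrite tr01E1.
Qed.

Lemma swap02_fix k m : (N <= m)%N -> swap02 (k, m) = (k, m).
Proof.
move=> Nm; have [->|->|->] := ord3P k; last 2 first.
- exact: swap02E1.
- rewrite swap02E tr01E2 swap12_fix //.
  by have := hVK s (p2, m); rewrite tr01E2.
rewrite swap02E; have e : s (p0, m) = (p0, m - N)%N by rewrite tr01E0 Nm.
by rewrite e swap12E0 -e hVK.
Qed.

Lemma swap02_lt x : (x.2 < N)%N -> ((swap02 x).2 < N)%N.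
Proof.
by case: x => k m /= mN; have [->|->|->] := ord3P k;
  rewrite ?swap02E0 ?swap02E1 ?swap02E2 //=; lia.
Qed.
Lemma swap_not_commute : (0 < N)%N ->
  (swap12 * swap02) (p2, 0) <> (swap02 * swap12) (p2, 0).
Proof.
move=> N0; rewrite !hM swap02E2 // swap12E2 // swap12E0 swap02E1.
by move=> /(congr1 fst)/(congr1 val).
Qed.
End Commutators.

(** The factor two comes from [p0], whose point at height [m] lands at height [D.-1 - m] of [p2]. *)
Lemma tr01_02_ge N D k m : (N + N <= D)%N -> (m < N)%N ->
  (N <= ((tr01 ^+ D * tr02 ^+ D)%g (k, m)).2)%N.
Proof.
move=> ND mN; have [->|->|->] := ord3P k.
- by rewrite hM tr02E0 ifF ?tr01E2 /=; lia.
- by rewrite hM tr02E1 tr01E1 /=; lia.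
- by rewrite hM tr02E2 tr01E2 /=; lia.
Qed.

(* The conjugating element moves the support of [swap12 N] off that of
   [swap02 N]. *)
Lemma swap12J_commute N D (w := tr01 ^+ D * tr02 ^+ D) : (N + N <= D)%N ->
  commute (w * swap12 N * w^-1) (swap02 N).
Proof.
move=> ND; have wge x : (x.2 < N)%N -> (N <= (w x).2)%N.
  by case: x => k m; apply: tr01_02_ge.
clearbody w; have c_fix x : (N <= x.2)%N -> swap12 N x = x.
  by case: x => k m; apply: swap12_fix.
set f := w * _ * _; set g := swap02 N.
have f_fix x : (x.2 < N)%N -> f x = x.
  move=> xN; rewrite !hM; case: (ltnP ((w^-1) x).2 N) => [/wge|].
    by rewrite hKV leqNgt xN.
  by move/c_fix=> ->; rewrite hKV.
have g_fix x : (N <= x.2)%N -> g x = x.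
  by case: x => k m; apply: swap02_fix.
apply: houghton_ext => x; rewrite -[LHS]/(f (g x)) -[RHS]/(g (f x)).
have [xN|Nx] := ltnP x.2 N.
  by rewrite (f_fix x) // f_fix //; apply: swap02_lt.
rewrite (g_fix x) // g_fix //; case: (ltnP (f x).2 N) => // fxN.
by have := f_fix _ fxN => /h_inj e; rewrite e ltnNge Nx in fxN.
Qed.

(** * Actions on locally finite trees *)

Section TreeFinite.
Variable T : tree.
Implicit Types v w x : T.

Lemma dist1_adj v w : dist v w = 1%N -> adj v w.
Proof.
rewrite /dist; have := geo_path v w; have := geo_last v w.
by case: (geo v w) => [|x []] //= <- /andP[].
Qed.

Lemma ball_finite v r : locally_finite T -> finite_set [set w | dist v w <= r]%N.
Proof.
move=> lf; elim: r => [|r IHr].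
  apply: (sub_finite_set _ (finite_set1 v)) => w /=.
  by rewrite leqn0 => /eqP /dist0 ->.
apply: (@sub_finite_set _ _ ([set w | dist v w <= r]%N `|`
    \bigcup_(x in [set w | dist v w <= r]%N) [set w | adj x w])).
  move=> w /=; rewrite leq_eqVlt => /orP[/eqP|]; last by left.
  rewrite {1}/dist; have := geo_path v w; have := geo_last v w.
  case/lastP: (geo v w) => [//|p x]; rewrite last_rcons rcons_path size_rcons.
  move=> -> /andP[pP pw] [<-]; right; exists (last v p) => //=.
  exact: dist_path.
rewrite finite_setU; split=> //; apply: bigcup_finite => // x _; exact: lf.
Qed.
End TreeFinite.

(** * Triviality of 3-cycles on one locally finite tree *)

Section LocallyFiniteTree.
Variables (T : tree) (H : houghton 3 -> Prop) (act : houghton 3 -> T -> T).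
Hypotheses (lfT : locally_finite T) (H1 : H 1).
Hypotheses (HM : forall f g, H f -> H g -> H (f * g)).
Hypotheses (HV : forall f, H f -> H f^-1).
Hypotheses (act1 : forall v, act 1 v = v).
Hypotheses (actM : forall f g v, H f -> H g -> act (f * g) v = act f (act g v)).
Hypotheses (act_iso : forall f, H f -> isometry_of (act f)).
Hypothesis H_cyc : forall a b c, a != b -> b != c -> a != c -> H (cyc a b c).
Implicit Types (f g : houghton 3) (v w : T).

Let HX f k : H f -> H (f ^+ k).
Proof. by move=> Hf; elim: k => // k IHk; rewrite expgS; apply: HM. Qed.

Let actVK f v : H f -> act f^-1 (act f v) = v.
Proof. by move=> Hf; rewrite -actM ?mulVg ?act1 //; apply: HV. Qed.

Let actKV f v : H f -> act f (act f^-1 v) = v.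
Proof. by move=> Hf; rewrite -actM ?mulgV ?act1 //; apply: HV. Qed.

Let act_inj f : H f -> injective (act f).
Proof. by move=> Hf; apply: can_inj (fun v => actVK v Hf). Qed.

(** The condition [H f] is carried along because [act] is assumed to be an action only on [H]. *)
Let trivial f := H f /\ forall v, act f v = v.

Let trivialJ f k : H f -> trivial k -> trivial (f * k * f^-1).
Proof.
move=> Hf [Hk tk]; have HVf := HV Hf; have Hfk := HM Hf Hk.
by split=> [|v]; [apply: HM|rewrite !actM // tk actKV].
Qed.

Let trivialM f g : trivial f -> trivial g -> trivial (f * g).
Proof.
by move=> [Hf tf] [Hg tg]; split=> [|v]; [apply: HM|rewrite actM // tg tf].
Qed.

Let trivialV f : trivial f -> trivial f^-1.
Proof.
by move=> [Hf tf]; split=> [|v]; [apply: HV|rewrite -{1}(tf v) actVK].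
Qed.

Let pair_inj i : injective (fun m : nat => (i : 'I_3, m)).
Proof. by move=> m m' []. Qed.

Let trivial_cyc_spread p q r : uniq [:: p; q; r] -> trivial (cyc p q r) ->
  forall a b c, a != b -> b != c -> a != c -> trivial (cyc a b c).
Proof.
move=> u t a b c ab bc ac.
apply: (@spread (fun=> True) _ (@pair_inj p0) (fun=> I) H trivial _
  trivialJ p q r u I I I t a b c I I I ab bc ac) => x y z _ _ _; exact: H_cyc.
Qed.

(** The commutator of [z] with [cyc p q a] acts trivially. It is also a quotient of two 3-cycles
    sharing [p] and [q], hence a 3-cycle, from which [trivial_cyc_spread] reaches all others. *)
Lemma trivial_cyc_of_nontrivial z a p q : trivial z -> z a <> a ->
  z p = p -> z q = q -> p <> q ->
  forall a b c, a != b -> b != c -> a != c -> trivial (cyc a b c).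
Proof.
move=> tz /eqP za zp zq /eqP pq.
have ap : a != p by apply: contra_neq za => ->.
have aq : a != q by apply: contra_neq za => ->.
have zap : z a != p by rewrite -{1}zp (inj_eq (@h_inj z)).
have zaq : z a != q by rewrite -{1}zq (inj_eq (@h_inj z)).
apply: (@trivial_cyc_spread q (z a) a).
  by rewrite /= !inE !negb_or (eq_sym q (z a)) zaq (eq_sym q a) aq za.
rewrite -(@cyc_div p q a (z a)); last first.
  rewrite /= !inE !negb_or pq (eq_sym p a) ap (eq_sym p (z a)) zap.
  by rewrite (eq_sym q a) aq (eq_sym q (z a)) zaq eq_sym za.
rewrite -{2}zp -{2}zq -cycJ.
have Hy : H (cyc p q a) by apply: H_cyc; rewrite // eq_sym.
rewrite !mulgA; apply: trivialM; last exact: trivialV.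
by rewrite -{2}(invgK (cyc p q a)); apply: trivialJ => //; apply: HV.
Qed.

(** The 3-cycles on the prong permute the finitely many neighbours of [v], and [finite_quotient_cyc]
    makes this permutation trivial. *)
Let prong_nbr i v w : adj v w ->
  (forall a b c, a.1 = i -> b.1 = i -> c.1 = i -> a != b -> b != c -> a != c ->
     act (cyc a b c) v = v) ->
  forall a b c, a.1 = i -> b.1 = i -> c.1 = i -> a != b -> b != c -> a != c ->
     act (cyc a b c) w = w.
Proof.
move=> vw fixv a b c ai bi ci ab bc ac.
have /finite_seqP[s sE] := lfT v.
have inS x : adj v x = (x \in s).
  by apply/idP/idP => h; [have: [set` s] x by rewrite -sE|
    have: [set w | adj v w] x by rewrite sE].
pose K f := H f /\ forall x, adj v x -> act f x = x.
pose L f := H f /\ act f v = v.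
have Ladj f x : L f -> adj v x -> adj v (act f x).
  by move=> [Hf fv] vx; apply: dist1_adj; rewrite -{1}fv act_iso // dist_adj.
(* The type [option] makes [phi] total; for [f] in [L] the images are neighbours of [v], so [None]
   does not occur. *)
pose phi f := [ffun x : seq_sub s => insub (act f (val x)) : option (seq_sub s)].
suff [_ ->] : K (cyc a b c) by [].
apply: (@finite_quotient_cyc (fun x => x.1 = i) _ (@pair_inj i) _ L K _ _ _ phi) => //.
- by move=> x y z xi yi zi xy yz xz; split; [apply: H_cyc|apply: fixv].
- move=> f k [Hf fv] [Hk kv]; have HVf := HV Hf; have Hfk := HM Hf Hk.
  split=> [|x vx]; first exact: HM.
  rewrite !actM // kv ?actKV //; apply: Ladj => //.
  by split=> //; rewrite -{1}fv actVK.
move=> f g Lf Lg e; have [[Hf fv] [Hg gv]] := (Lf, Lg).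
split=> [|x vx]; first by apply: HM => //; apply: HV.
have xs : x \in s by rewrite -inS.
have := congr1 (fun h : {ffun _ -> _} => h (SeqSub xs)) e; rewrite !ffunE /=.
have fs : act f x \in s by rewrite -inS; apply: Ladj.
have gs : act g x \in s by rewrite -inS; apply: Ladj.
rewrite !insubT // => -[fg]; rewrite actM //; last exact: HV.
by rewrite -fg actVK.
Qed.

Lemma trivial_of_prong_fix i v :
  (forall a b c, a.1 = i -> b.1 = i -> c.1 = i -> a != b -> b != c -> a != c ->
     act (cyc a b c) v = v) ->
  forall a b c, a != b -> b != c -> a != c -> trivial (cyc a b c).
Proof.
move=> fixv; have ne k m : k != m -> (i, k) != (i, m) :> 'I_3 * nat.
  by move=> km; apply/eqP => -[] /eqP; rewrite (negbTE km).
apply: (@trivial_cyc_spread (i, 0) (i, 1%N) (i, 2)) => //.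
  by rewrite /= !inE !negb_or !ne.
split=> [|w]; first by apply: H_cyc; apply: ne.
have [p pP <-] := tree_connected v w.
elim: p v fixv pP => [|x p IHp] v fixv /=; first by move=> _; apply: fixv; rewrite ?ne.
by move=> /andP[vx pP]; apply: (IHp x) => //; apply: (prong_nbr vx).
Qed.

(** A 3-cycle on the prong commutes with [f], which fixes the prong pointwise, and has a fixed
    vertex, being of order three. So it fixes each vertex of minimal displacement under [f]. *)
Lemma trivial_of_no_fix f i : H f -> (forall m, f (i, m) = (i, m)) ->
  (forall v, act f v <> v) ->
  forall a b c, a != b -> b != c -> a != c -> trivial (cyc a b c).
Proof.
move=> Hf fi nofix; have [v0] : inhabited T by case: (T).
have [v _ minv] := @exists_argmin _ (fun=> True) (fun v => dist v (act f v)) v0 I.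
apply: (@trivial_of_prong_fix i v) => a b c ai bi ci ab bc ac.
have fE x : x.1 = i -> f x = x by case: x => k m /= ->; apply: fi.
have Hc : H (cyc a b c) by apply: H_cyc.
have fc : cyc a b c * f = f * cyc a b c.
  apply: (mulIg f^-1); rewrite mulgK cycJ !fE //.
have [w cw] : exists w, act (cyc a b c) w = w.
  apply: fix_order3 => [|x]; first exact: act_iso.
  have Hcc := HM Hc Hc.
  by rewrite -[act _ (act _ x)]actM // -actM // cyc3 // act1.
apply: (@fix_of_commuting _ _ (act f) _ w) => //; try exact: act_iso.
- by move=> x; exists (act f^-1 x); rewrite actKV.
- by move=> x; rewrite -!actM // fc.
- by move=> x; apply: minv.
Qed.

Section Powers.
Variable N : nat.
Hypotheses (N_gt0 : (0 < N)%N).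
Let s := tr01 ^+ N.
Let u := tr02 ^+ N.
Hypotheses (Hs : H s) (Hu : H u).

(** [f] permutes the finite ball around its fixed vertex. Multiples of the period are included so
    that two elements can share an exponent. *)
Let ball_power f v r : H f -> act f v = v ->
  exists2 k, (0 < k)%N & forall m w, (dist v w <= r)%N -> act (f ^+ (m * k)) w = w.
Proof.
move=> Hf fv; have /finite_seqP[t tE] := ball_finite v r lfT.
have inT x : (dist v x <= r)%N = (x \in t).
  by apply/idP/idP => h; [have: [set` t] x by rewrite -tE|
    have: [set w | dist v w <= r]%N x by rewrite tE].
have ft (x : seq_sub t) : act f (val x) \in t.
  by rewrite -inT -{1}fv act_iso // inT; apply: valP.
pose F x : seq_sub t := SeqSub (ft x).
have Finj : injective F.
  by move=> x y /(congr1 val) /= /(act_inj Hf) /val_inj.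
have [k k0 Fk] := inj_iter_id Finj; exists k => // m w; rewrite inT => wt.
have iterF j (x : seq_sub t) : val (iter j F x) = act (f ^+ j) (val x).
  elim: j => [|j IHj] /=; first by rewrite expg0 act1.
  by rewrite IHj expgS actM //; apply: HX.
have fk : act (f ^+ k) w = w by have := iterF k (SeqSub wt); rewrite Fk.
elim: m => [|m IHm]; first by rewrite mul0n expg0 act1.
by rewrite mulSn expgnDr actM ?IHm //; apply: HX.
Qed.

(* On the ball containing a given vertex, suitable powers of [s] and [u] act
   trivially, so there [swap12 N] acts as a conjugate commuting with
   [swap02 N]. *)
Lemma trivial_of_common_fix v : act s v = v -> act u v = v ->
  forall a b c, a != b -> b != c -> a != c -> trivial (cyc a b c).
Proof.
move=> sv uv; pose c := swap12 N; pose d := swap02 N.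
have Vfix f : H f -> act f v = v -> act f^-1 v = v.
  by move=> Hf fv; rewrite -{1}fv actVK.
have [Hc cv] : H c /\ act c v = v.
  rewrite /c /swap12 -lock -/s -/u.
  have [HVs HVu] := (HV Hs, HV Hu); have Hsu := HM Hs Hu; have Hsus := HM Hsu HVs.
  by split; [apply: HM|rewrite !actM // !Vfix // uv].
have [Hd dv] : H d /\ act d v = v.
  rewrite /d /swap02 -lock -/s -/c; have HVs := HV Hs; have HVsc := HM HVs Hc.
  by split; [apply: HM|rewrite !actM // sv cv Vfix].
have cd w : act c (act d w) = act d (act c w).
  have [k k0 sk] := ball_power (dist v w) Hs sv.
  have [l l0 ul] := ball_power (dist v w) Hu uv.
  (* A multiple of both periods; the factor [N + N] makes the exponent [N * M] large enough for
     [swap12J_commute]. *)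
  pose M := ((N + N) * k * l)%N.
  pose q := tr01 ^+ (N * M) * tr02 ^+ (N * M).
  have Hsm : H (s ^+ M) := HX _ Hs; have Hum : H (u ^+ M) := HX _ Hu.
  have qE : q = s ^+ M * u ^+ M by rewrite /q !expgnA.
  have Hq : H q by rewrite qE; apply: HM.
  have qfix x : (dist v x <= dist v w)%N -> act q x = x.
    have ME : M = ((N + N) * l * k)%N by rewrite /M -!mulnA (mulnC k).
    by move=> xw; rewrite qE actM // (ul ((N + N) * k)%N) // ME sk.
  have com : commute (q * c * q^-1) d.
    apply: swap12J_commute; rewrite /M -[X in (X <= _)%N]mul1n.
    rewrite -(mulnA (N + N)) (mulnCA N) mulnC leq_pmul2l ?addn_gt0 ?N_gt0 //.
    by rewrite !muln_gt0 N_gt0 k0 l0.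
  clearbody q; have cE x : (dist v x <= dist v w)%N -> act (q * c * q^-1) x = act c x.
    have HVq := HV Hq; have Hqc := HM Hq Hc.
    move=> xw; rewrite !actM //; rewrite -{1}(qfix x xw) actVK // qfix //.
    by rewrite -{1}cv act_iso.
  have Hqcq : H (q * c * q^-1) by apply: HM; [apply: HM|apply: HV].
  rewrite -cE; last by rewrite -{1}dv act_iso.
  by rewrite -actM // com actM // cE.
(* [z] acts trivially on the tree and fixes all points of height at least [N], but moves [(p2, 0)],
   where [c] and [d] do not commute. *)
pose z := (d * c)^-1 * (c * d).
have tz : trivial z.
  have Hdc := HM Hd Hc; have Hcd := HM Hc Hd.
  have HVdc := HV Hdc; split=> [|w]; first exact: HM.
  have cdw : act (c * d) w = act (d * c) w by rewrite !actM.
  by rewrite actM // cdw actVK.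
have zfix k m : (N <= m)%N -> z (k, m) = (k, m).
  move=> Nm; rewrite -[LHS]/((d * c)^-1 (c (d (k, m)))).
  rewrite swap02_fix // swap12_fix //.
  by rewrite -{1}(_ : (d * c) (k, m) = (k, m)) ?hVK // hM swap12_fix // swap02_fix.
apply: (@trivial_cyc_of_nontrivial z (p2, 0) (p0, N) (p1, N)) => //; try exact: zfix.
move=> /(congr1 (d * c)); rewrite -[_ (z _)]/((d * c) ((d * c)^-1 ((c * d) (p2, 0)))).
by rewrite hKV; apply: swap_not_commute.
Qed.

Lemma trivial_cyc a b c : a != b -> b != c -> a != c -> trivial (cyc a b c).
Proof.
have [[x sx]|nos] := pselect (exists x, act s x = x); last first.
  apply: (@trivial_of_no_fix s p2) => // [m|v sv]; first exact: tr01E2.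
  by apply: nos; exists v.
have [[y uy]|nou] := pselect (exists x, act u x = x); last first.
  apply: (@trivial_of_no_fix u p1) => // [m|v uv]; first exact: tr02E1.
  by apply: nou; exists v.
have HVu := HV Hu; have Hsu := HM Hs HVu.
have [[w suw]|nosu] := pselect (exists x, act (s * u^-1) x = x); last first.
  apply: (@trivial_of_no_fix (s * u^-1) p0) => // [m|v suv]; first exact: tr_divE0.
  by apply: nosu; exists v.
have [v [sv uv]] : exists v, act s v = v /\ act u v = v.
  (* Both [s] and [u] send the vertex [act u^-1 w] to [w]. *)
  apply: (@common_fix _ _ _ (act u^-1 w) x y) => //; try exact: act_iso.
  by rewrite actKV // -actM.
exact: (trivial_of_common_fix sv uv).
Qed.
End Powers.
End LocallyFiniteTree.

(** * From one tree to a product of trees *)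

Section NoProperAction.
Variables (n : nat) (T : 'I_n -> tree) (rho : action (houghton 3) T).
Hypothesis lfT : forall i, locally_finite (T i).

Let H f := pure (rho f).

Let HM f g : H f -> H g -> H (f * g).
Proof. by rewrite /H gmulfM; apply: pureM. Qed.

Let HV f : H f -> H f^-1.
Proof. by rewrite /H gmulfV; apply: pureV. Qed.

Let H1 : H 1.
Proof. by rewrite /H gmulf1; apply: pure1. Qed.

Let permM f g i :
  aut_perm_fun (rho (f * g)) i = aut_perm_fun (rho f) (aut_perm_fun (rho g) i).
Proof. by rewrite gmulfM aut_perm_funM. Qed.

Let perm_inj f : injective (aut_perm_fun (rho f)).
Proof. exact: aut_perm_fun_inj. Qed.

(** The induced permutation of the factors takes finitely many values, so [finite_quotient_cyc] puts
    every 3-cycle in the kernel. *)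
Let H_cyc a b c : a != b -> b != c -> a != c -> H (cyc a b c).
Proof.
pose phi f := [ffun i => aut_perm_fun (rho f) i].
have ys_inj : injective (fun m => (p0, m) : 'I_3 * nat) by move=> m m' [].
apply: (@finite_quotient_cyc (fun=> True) _ ys_inj (fun=> I) (fun=> True) H _ _
  _ phi) => // [f k _ Hk i|f g _ _ /ffunP e i].
  by rewrite !permM Hk -permM mulgV H1.
by apply: (@perm_inj f); rewrite -permM mulVKg; move: (e i); rewrite !ffunE.
Qed.

Section Factor.
Variables (x0 : vertices T) (i : 'I_n).

(** [x0] only fills the other coordinates; for [f] in [H] its choice is immaterial by
    [pure_coord]. *)
Definition factor_act f (v : T i) : T i := rho f (upd x0 v) i.

Lemma factor_actE f x : H f -> rho f x i = factor_act f (x i).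
Proof. by move=> Hf; apply: pure_coord => //; rewrite upd_in. Qed.

Lemma factor_actM f g v : H f -> H g ->
  factor_act (f * g) v = factor_act f (factor_act g v).
Proof. by move=> Hf _; rewrite {1}/factor_act gmulfM autM; apply: factor_actE. Qed.

Lemma factor_act1 v : factor_act 1 v = v.
Proof. by rewrite /factor_act gmulf1; apply: upd_in. Qed.

Lemma factor_act_iso f : H f -> isometry_of (factor_act f).
Proof.
have adjf g : H g -> {homo factor_act g : v w / adj v w}.
  by move=> Hg v w /(padj_upd x0) /(pure_padj Hg) [].
move=> Hf v w; apply/eqP; rewrite eqn_leq (dist_homo (adjf _ Hf)) /=.
have HVf := HV Hf; have := dist_homo (adjf _ HVf) (factor_act f v) (factor_act f w).
by rewrite -!factor_actM // mulVg !factor_act1.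
Qed.
End Factor.

Lemma not_proper_action : ~ proper_action rho.
Proof.
have ne i : exists _ : T i, True by have [v] : inhabited (T i) by case: (T i).
pose x0 : vertices T := fun i => projT1 (cid (ne i)).
move=> /(_ x0) /finite_seqP[s sE].
(* Infinitely many 3-cycles, told apart by their value at [(p0, 1)]; all will turn out to fix
   [x0]. *)
pose ys k := cyc (p0, 0) (p0, 1%N) (p0, k.+2).
have [k /negP] : exists k, ys k \notin s.
  apply: fresh => k l /(congr1 (fun f : houghton 3 => f (p0, 1%N))).
  by rewrite /ys /= !cycE // => -[].
apply; suff : [set g | rho g x0 = x0] (ys k) by rewrite sE.
have [k1 k1_gt0 Hk1] := pure_power (rho tr01).
have [k2 k2_gt0 Hk2] := pure_power (rho tr02).
apply: vertices_ext => i; rewrite (@factor_actE x0) //; last exact: H_cyc.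
(* The product of the two exponents makes both powers pure at once. *)
have H1N : H (tr01 ^+ (k1 * k2)).
  by rewrite expgnA /H gmulfXn; apply/pureX; rewrite gmulfXn.
have H2N : H (tr02 ^+ (k1 * k2)).
  by rewrite mulnC expgnA /H gmulfXn; apply/pureX; rewrite gmulfXn.
have N_gt0 : (0 < k1 * k2)%N by rewrite muln_gt0 k1_gt0.
have [_ -> //] := @trivial_cyc (T i) H (@factor_act x0 i) (@lfT i) H1 HM HV
  (@factor_act1 x0 i) (@factor_actM x0 i) (@factor_act_iso x0 i) H_cyc
  (k1 * k2)%N N_gt0 H1N H2N (p0, 0) (p0, 1%N) (p0, k.+2) isT isT isT.
Qed.
End NoProperAction.

(** * The proper action on three trees *)

Lemma finite_set_inj (A : choiceType) (Q : finType) (S : set A) (phi : A -> Q) :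
  (forall x y, S x -> S y -> phi x = phi y -> x = y) -> finite_set S.
Proof.
move=> phi_inj; have [[x0 _]|S0] := pselect (S !=set0); last first.
  by apply: (sub_finite_set _ (finite_set0 A)) => x Sx; case: S0; exists x.
pose pick q := xget x0 [set x | S x /\ phi x = q].
apply: (sub_finite_set _ (finite_image pick (@finite_finset Q setT))) => x Sx.
exists (phi x) => //; rewrite /pick; case: xgetP => [y _ [Sy e]|/(_ x) []//].
exact: phi_inj.
Qed.

(** * Trees defined by a parent map *)

Section ParentTree.
Variables (V : choiceType) (par : V -> V) (lev : V -> int).
Hypothesis lev_par : forall v, lev (par v) = (lev v + 1)%R.
Hypothesis par_meet : forall v w, exists m n, iter m par v = iter n par w.

Definition parent_adj : rel V := fun v w => (w == par v) || (v == par w).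

Lemma parent_adj_sym : symmetric parent_adj.
Proof. by move=> v w; rewrite /parent_adj orbC. Qed.

Lemma parent_adj_irr : irreflexive parent_adj.
Proof.
move=> v; rewrite /parent_adj orbb; apply/eqP => /(congr1 lev).
by rewrite lev_par; lia.
Qed.

Lemma parent_connected v w : exists2 p, path parent_adj v p & last v p = w.
Proof.
have up m : forall u, exists2 p, path parent_adj u p & last u p = iter m par u.
  elim: m => [|m IHm] u; first by exists [::].
  have [p pP lp] := IHm (par u); exists (par u :: p); last by rewrite /= lp -iterSr.
  by rewrite /= pP /parent_adj eqxx.
have [m [n e]] := par_meet v w.
have [p pP lp] := up m v; have [q qP lq] := up n w.
exists (p ++ rev (belast w q)).
  rewrite cat_path pP lp e -lq rev_path.
  by rewrite (eq_path (e' := parent_adj)) // => s t; rewrite parent_adj_sym.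
rewrite last_cat; case: q {qP} lq => [|x q] /= lq; first by rewrite lp e -lq.
by rewrite rev_cons last_rcons.
Qed.

(** On a cycle, both neighbours of a vertex of least level must be its parent, so they coincide. *)
Lemma parent_acyclic c : ucycle parent_adj c -> (size c <= 2)%N.
Proof.
case: c => [//|x0 c0]; set c := x0 :: c0 => /andP[cP cu].
have [v vc minv] : exists2 v, v \in c & forall w, w \in c -> (lev v <= lev w)%R.
  move: (c0) (x0) @c cP cu => l y c _ _; rewrite {}/c; elim: l y => [|x c IHc] {}x0.
    by exists x0; rewrite ?inE // => w; rewrite inE => /eqP ->.
  have [v vc minv] := IHc x; have [le0|lt0] := lerP (lev x0) (lev v).
    exists x0; rewrite ?inE ?eqxx // => w; rewrite inE => /orP[/eqP ->//|wc].
    exact: le_trans le0 (minv _ wc).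
  exists v; first by rewrite inE vc orbT.
  by move=> w; rewrite inE => /orP[/eqP ->|/minv //]; apply: ltW.
have par_of w : w \in c -> parent_adj v w -> w = par v.
  move=> /minv le_vw /orP[/eqP //|/eqP e].
  by move: le_vw; rewrite {1}e lev_par; lia.
have [i c' rc] := rot_to vc.
have : cycle parent_adj (v :: c') by rewrite -rc rot_cycle.
have : uniq (v :: c') by rewrite -rc rot_uniq.
have memc w : (w \in v :: c') = (w \in c) by rewrite -rc mem_rot.
have -> : size c = (size c').+1 by rewrite -(size_rot i) rc.
case: c' memc {rc} => [|a c'] // memc; case/lastP: c' memc => [|c' b] // memc.
move=> /= /and3P[_ ac _] /andP[va]; rewrite rcons_path last_rcons => /andP[_ bv].
have ea : a = par v by apply: par_of => //; rewrite -memc !inE eqxx orbT.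
have eb : b = par v.
  apply: par_of; last by rewrite parent_adj_sym.
  by rewrite -memc !inE mem_rcons inE eqxx !orbT.
by rewrite ea eb mem_rcons inE eqxx in ac.
Qed.

Definition parent_tree (v : V) : tree :=
  Tree (inhabits v) parent_adj_sym parent_adj_irr parent_connected parent_acyclic.
End ParentTree.

Lemma image_can (A : Type) (f g : A -> A) (c : set A) :
  cancel f g -> g @` (f @` c) = c.
Proof.
move=> fK; rewrite image_comp -[RHS]image_id; apply: eq_imagel => x _; exact: fK.
Qed.

Lemma is_aut_of (V : Type) (C : set (set V)) (f : sym V) :
  (forall c, C c -> C (f @` c)) -> (forall c, C c -> C (f^-1 @` c)) ->
  f \in is_aut C.
Proof.
move=> fC fVC; apply/asboolP => c; split; last exact: fC.
by move=> /fVC; rewrite image_can //; apply: symVK.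
Qed.

Lemma simplices_image (T : tree) (f : T -> T) :
  {homo f : v w / adj v w} -> forall c, simplices T c -> simplices T (f @` c).
Proof.
move=> fadj c [[v ->]|[v [w [vw ->]]]]; first by left; exists (f v); rewrite image_set1.
right; exists (f v), (f w); split; first exact: fadj.
by rewrite image_setU !image_set1.
Qed.

(** * The trees of eventual tails of prongs *)

Section RayTrees.
Let X := ('I_3 * nat)%type.
Implicit Types (g : houghton 3) (i : 'I_3).

Definition is_ray i (phi : nat -> X) (k : int) := exists N, forall m, (N <= m)%N ->
  (phi m).1 = i /\ ((phi m).2%:Z = k + m%:Z :> int)%R.

(* The vertices of the tree attached to prong [i]; the parent of a vertex drops
   the first term of the sequence. *)
Record ray i := Ray { ray_fun :> nat -> X; rayP : exists k, is_ray i ray_fun k }.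

HB.instance Definition _ i := gen_eqMixin (ray i).
HB.instance Definition _ i := gen_choiceMixin (ray i).

Lemma ray_ext i (phi psi : ray i) : phi =1 psi -> phi = psi.
Proof.
case: phi psi => [f fP] [h hP] /= /funext fh; rewrite fh in fP *.
by rewrite (Prop_irrelevance fP hP).
Qed.

Definition ray_lev i (phi : ray i) : int := projT1 (cid (rayP phi)).

Lemma ray_levP i (phi : ray i) : is_ray i phi (ray_lev phi).
Proof. by rewrite /ray_lev; case: cid. Qed.

Lemma is_ray_uniq i phi k l : is_ray i phi k -> is_ray i phi l -> k = l.
Proof.
move=> [N hN] [M hM].
by have [_ a] := hN _ (leq_addr M N); have [_] := hM _ (leq_addl N M); lia.
Qed.

Lemma ray_parP i (phi : ray i) : is_ray i (phi \o succn) (ray_lev phi + 1)%R.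
Proof.
have [N hN] := ray_levP phi; exists N => m Nm.
by have [/= -> ->] := hN m.+1 (leqW Nm); split=> //; lia.
Qed.

Definition ray_par i (phi : ray i) : ray i := Ray (ex_intro _ _ (ray_parP phi)).

Lemma ray_lev_par i (phi : ray i) : ray_lev (ray_par phi) = (ray_lev phi + 1)%R.
Proof.
by apply: (@is_ray_uniq i (ray_par phi)); [apply: ray_levP|apply: ray_parP].
Qed.

Lemma iter_ray_par i (phi : ray i) m j : iter m (@ray_par i) phi j = phi (m + j)%N.
Proof. by elim: m j => [//|m IHm] j; rewrite iterS /= IHm addnS. Qed.

(** Both sequences end by running along the prong with unit speed, so suitable numbers of dropped
    terms align them. *)
Lemma ray_meet i (phi psi : ray i) :
  exists m n, iter m (@ray_par i) phi = iter n (@ray_par i) psi.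
Proof.
have [N hN] := ray_levP phi; have [M hM] := ray_levP psi.
set k := ray_lev phi in hN; set l := ray_lev psi in hM.
have [m [n [Nm Mn e]]] : exists m n,
    [/\ (N <= m)%N, (M <= n)%N & (k + m%:Z = l + n%:Z)%R].
  have [kl|lk] := lerP k l.
    by exists (N + M + `|l - k|)%N, (N + M)%N; split; lia.
  by exists (N + M)%N, (N + M + `|k - l|)%N; split; lia.
exists m, n; apply: ray_ext => j; rewrite !iter_ray_par.
have [a b] := hN (m + j)%N (leq_trans Nm (leq_addr _ _)).
have [a' b'] := hM (n + j)%N (leq_trans Mn (leq_addr _ _)).
by rewrite [LHS]surjective_pairing [RHS]surjective_pairing a a'; congr (_, _); lia.
Qed.

Lemma base_rayP i : is_ray i (fun m => (i, m)) 0%R.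
Proof. by exists 0%N => m _; rewrite add0r. Qed.

Definition base_ray i : ray i := Ray (ex_intro _ _ (base_rayP i)).

Definition ray_tree i : tree :=
  parent_tree (@ray_lev_par i) (@ray_meet i) (base_ray i).

Lemma ray_actP g i (phi : ray i) : exists k, is_ray i (fun m => g (phi m)) k.
Proof.
have /asboolP[t gt] : val g \in @is_houghton 3 by apply: valP.
have [N hN] := ray_levP phi; have [M hM] := gt i.
exists (ray_lev phi + t i)%R, (N + M + `|ray_lev phi|)%N => m le_m.
have [a b] := hN m ltac:(lia).
have [c d] := hM (phi m).2 ltac:(lia).
rewrite [phi m]surjective_pairing a; split=> //.
by move: d; rewrite /= => ->; lia.
Qed.

Definition ray_act g i (phi : ray i) : ray i := Ray (ray_actP g phi).

Lemma ray_actM g h i (phi : ray i) : ray_act (g * h) phi = ray_act g (ray_act h phi).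
Proof. exact: ray_ext. Qed.

Lemma ray_act1 i (phi : ray i) : ray_act 1 phi = phi.
Proof. exact: ray_ext. Qed.

Lemma ray_actK g i : cancel (@ray_act g i) (@ray_act g^-1 i).
Proof. by move=> phi; rewrite -ray_actM mulVg ray_act1. Qed.

Lemma ray_actVK g i : cancel (@ray_act g^-1 i) (@ray_act g i).
Proof. by move=> phi; rewrite -ray_actM mulgV ray_act1. Qed.

Lemma ray_act_adj g i :
  {homo (@ray_act g i : ray_tree i -> ray_tree i) : v w / adj v w}.
Proof.
move=> v w /orP[/eqP ->|/eqP ->]; apply/orP; [left|right]; apply/eqP; exact: ray_ext.
Qed.

Definition ray_sym g i : sym (ray_tree i) :=
  Sym (Bijective (@ray_actK g i) (@ray_actVK g i)).

Lemma ray_symV g i : (ray_sym g i)^-1 =1 @ray_act g^-1 i.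
Proof. by move=> v; rewrite -[v in LHS](@ray_actVK g) symVK. Qed.

Lemma ray_sym_aut g i : ray_sym g i \in is_aut (simplices (ray_tree i)).
Proof.
apply: is_aut_of => c; apply: simplices_image; first exact: ray_act_adj.
by move=> v w vw; rewrite !ray_symV; apply: ray_act_adj.
Qed.

Definition prod_act g (x : vertices ray_tree) : vertices ray_tree :=
  fun i => ray_act g (x i).

Lemma prod_actK g : cancel (prod_act g) (prod_act g^-1).
Proof. by move=> x; apply: vertices_ext => i; apply: ray_actK. Qed.

Lemma prod_actVK g : cancel (prod_act g^-1) (prod_act g).
Proof. by move=> x; apply: vertices_ext => i; apply: ray_actVK. Qed.

Definition prod_sym g : sym (vertices ray_tree) :=
  Sym (Bijective (prod_actK g) (prod_actVK g)).

Lemma prod_symV g : ((prod_sym g)^-1 : _ -> _) = prod_act g^-1.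
Proof. by apply/funext => x; rewrite -[x in LHS](@prod_actVK g) symVK. Qed.

Lemma prod_act_cubes g c : cubes ray_tree c -> cubes ray_tree (prod_act g @` c).
Proof.
move=> [s [ss ->]]; exists (fun i => @ray_act g i @` s i); split.
  by move=> i; apply: simplices_image => //; apply: ray_act_adj.
rewrite eqEsubset; split=> [_ [x sx <-] i|x /= h]; first by exists (x i).
exists (prod_act g^-1 x) => [i|]; last exact: prod_actVK.
by have [v sv e] := h i; rewrite /prod_act -e ray_actK.
Qed.

Lemma prod_sym_aut g : prod_sym g \in is_aut (cubes ray_tree).
Proof.
by apply: is_aut_of => c; rewrite ?prod_symV; apply: prod_act_cubes.
Qed.

Definition ray_rho g : aut (cubes ray_tree) := Aut (prod_sym_aut g).

Lemma ray_rho1 : ray_rho 1 = 1.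
Proof.
apply/val_inj/sym_ext => x; apply: vertices_ext => i; exact: ray_act1.
Qed.

Lemma ray_rhoM : {morph ray_rho : g h / g * h}.
Proof.
move=> g h; apply/val_inj/sym_ext => x; apply: vertices_ext => i; exact: ray_actM.
Qed.

HB.instance Definition _ :=
  isMultiplicative.Build (houghton 3) (aut (cubes ray_tree)) ray_rho ray_rhoM.
HB.instance Definition _ :=
  Multiplicative_isUMagmaMorphism.Build (houghton 3) (aut (cubes ray_tree))
    ray_rho ray_rho1.

(** The terms of the three sequences [x i] cover all points beyond some height [M]. An element of
    the stabiliser fixes these terms, so it is determined by its restriction to the finite box below
    [M], which it preserves. *)
Lemma ray_rho_proper : proper_action (ray_rho : action (houghton 3) ray_tree).
Proof.
move=> x.
have [M hM] : exists M, forall i m, (M <= m)%N -> exists j, x i j = (i, m).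
  have h i : exists M, forall m, (M <= m)%N -> exists j, x i j = (i, m).
    have [N hN] := ray_levP (x i); exists (`|(ray_lev (x i) + N%:Z)%R| + N)%N => m le_m.
    have [a b] := hN `|(m%:Z - ray_lev (x i))%R|%N ltac:(lia).
    exists `|(m%:Z - ray_lev (x i))%R|%N.
    by rewrite [LHS]surjective_pairing a; congr (_, _); lia.
  pose B i := projT1 (cid (h i)).
  exists (\max_i B i)%N => i m le_m.
  apply: (projT2 (cid (h i)) m); apply: leq_trans le_m.
  by rewrite -/(B i) (bigD1 i) //= leq_maxl.
have fixg g : ray_rho g x = x -> forall y, (M <= y.2)%N -> g y = y.
  move=> gx [i m] /(hM i)[j <-].
  by have := congr1 (fun y : vertices ray_tree => y i j) gx.
have ltg g y : ray_rho g x = x -> (y.2 < M)%N -> ((g y).2 < M)%N.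
  move=> /fixg gx yM; rewrite ltnNge; apply/negP => le_gy.
  by have /h_inj e := gx _ le_gy; rewrite e leqNgt yM in le_gy.
(* The ordinal type has one element too many because [inord] requires a successor; heights below [M]
   are recovered exactly. *)
pose phi g := [ffun y : 'I_3 * 'I_M.+1 => let z := g (y.1, val y.2) in
  (z.1, inord z.2) : 'I_3 * 'I_M.+1].
apply: (finite_set_inj (phi := phi)) => g h /= gx hx /ffunP e.
apply: houghton_ext => -[i m]; have [Mm|mM] := leqP M m.
  by rewrite !fixg.
have := e (i, inord m); rewrite !ffunE /= inordK; last exact: ltnW.
move=> [e1 /(congr1 val)]; rewrite /= !inordK; last 2 first.
- exact/ltnW/ltg.
- exact/ltnW/ltg.
by move=> e2; rewrite [LHS]surjective_pairing e1 e2 -surjective_pairing.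
Qed.

Lemma ray_rho_pure : preserves_factors (ray_rho : action (houghton 3) ray_tree).
Proof. by move=> g; exists (fun i => Aut (ray_sym_aut g i)). Qed.
End RayTrees.

(** * Finite presentation *)

Section Conj.
Variable G : groupType.
Implicit Types a b x y : G.

Definition cj a x := a * x * a^-1.

Lemma cjM a x y : cj a (x * y) = cj a x * cj a y.
Proof. by rewrite /cj !mulgA mulgVK. Qed.

Lemma cj_comp a b x : cj (a * b) x = cj a (cj b x).
Proof. by rewrite /cj invgM !mulgA. Qed.

Lemma cj1 x : cj 1 x = x.
Proof. by rewrite /cj mul1g invg1 mulg1. Qed.

Lemma cjVK a x : cj a^-1 (cj a x) = x.
Proof. by rewrite -cj_comp mulVg cj1. Qed.
Lemma cj_commute a x : cj a x = x <-> commute a x.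
Proof. by rewrite /cj /commute; split=> [{2}<-|->]; rewrite ?mulgVK ?mulgK. Qed.

Lemma cjV a x y : cj a x = y -> cj a^-1 y = x.
Proof. by move=> <-; rewrite cjVK. Qed.

(** For transpositions of a base point with two distinct points, this is the transposition of those
    two points. *)
Definition tau x y := x * y * x.

Lemma cj_tau a x y : cj a (tau x y) = tau (cj a x) (cj a y).
Proof. by rewrite /tau !cjM. Qed.

Lemma commute_cj a x y : commute x y -> commute (cj a x) (cj a y).
Proof. by rewrite /commute -!cjM => ->. Qed.
End Conj.

(** The cyclic order of the prongs lets each family of relations be written for a single index. *)
Definition nx (i : 'I_3) : 'I_3 :=
  if i == p0 then p1 else if i == p1 then p2 else p0.

Lemma nx3 i : nx (nx (nx i)) = i.
Proof. by have [->|->|->] := ord3P i. Qed.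

Lemma nx_neq i : nx i != i.
Proof. by have [->|->|->] := ord3P i. Qed.

Lemma nx2_neq i : nx (nx i) != i.
Proof. by have [->|->|->] := ord3P i. Qed.

Lemma nxP i k : [\/ k = i, k = nx i | k = nx (nx i)].
Proof.
by have [->|->|->] := ord3P i; have [->|->|->] := ord3P k;
  by [apply: Or31|apply: Or32|apply: Or33].
Qed.

(** * The relations, and the transpositions defined from them *)

Section Relations.
Variables (G : groupType) (g t : 'I_3 -> G).

(* [g i] stands for the shift from prong [nx i] to prong [nx (nx i)] fixing a
   base point outside the prongs, and [t i] for the transposition of that base
   point with the origin of prong [i]. *)
Record houghton_rel : Prop := HoughtonRel {
  rel_gt : forall i, g i * t (nx i) * (g i)^-1 = t (nx (nx i));
  rel_fix : forall i, g i * t i * (g i)^-1 = t i;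
  rel_ggg : forall i, g (nx i) * g i * g (nx (nx i)) = 1;
  rel_gg : forall i, (g (nx i))^-1 * g i * g (nx i) =
    tau (t (nx (nx i))) (g i * t (nx (nx i)) * (g i)^-1) * g i;
  rel_t2 : forall i, t i * t i = 1;
  rel_braid : forall i, tau (t i) (t (nx i)) = tau (t (nx i)) (t i);
  rel_triple : forall i, tau (t i) (t (nx i)) * t (nx (nx i)) =
    t (nx (nx i)) * tau (t i) (t (nx i)) }.

Hypothesis relG : houghton_rel.

(** The abstract transposition of the base point with [y]: the shift [g (nx y.1)] pushes outwards
    along the prong of [y]. *)
Definition star_tr (y : 'I_3 * nat) : G := iter y.2 (cj (g (nx y.1))) (t y.1).

Local Notation T i m := (star_tr (i, m)).

Let T0 i : T i 0 = t i. Proof. by []. Qed.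

Let stepT i m : cj (g i) (T (nx (nx i)) m) = T (nx (nx i)) m.+1.
Proof. by rewrite /star_tr /= nx3. Qed.

Let gt i : cj (g i) (T (nx i) 0) = T (nx (nx i)) 0.
Proof. exact: rel_gt. Qed.

Let gcomp i x : cj (g (nx i)) (cj (g i) x) = cj (g (nx (nx i)))^-1 x.
Proof.
rewrite -cj_comp; congr cj; apply: (mulIg (g (nx (nx i)))).
by rewrite rel_ggg // mulVg.
Qed.

(** Simultaneous induction: [A m] gives [B m]; [A m] and [C m] give [A m.+1]; [A 1], [B m] and [C m]
    give [C m.+1]. Finitely many relations thus imply the infinite families. *)
Let A m := forall i, cj (g i) (T i m) = T i m.
Let B m := forall i, cj (g i) (T (nx i) m.+1) = T (nx i) m.
Let C m := forall i, commute (tau (T i 0) (T i 1%N)) (T (nx i) m).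

Let A_B m : A m -> B m.
Proof.
move=> Am i; rewrite -{1 2}(nx3 i) -stepT.
set j := nx (nx i); rewrite gcomp; apply: cjV; rewrite /j nx3.
exact: Am.
Qed.

Let A0 : A 0. Proof. by move=> i; apply: rel_fix. Qed.

(** Conjugation by [g (nx i)] carries the origins of [nx (nx i)], [i] and [nx i] to [(i, 0)],
    [(i, 1)] and [(nx i, 0)]. *)
Let C0 : C 0.
Proof.
move=> i; have := commute_cj (g (nx i)) (rel_triple relG (nx (nx i))).
rewrite nx3 cj_tau -!T0 A0.
have := gt (nx i); rewrite !nx3 => ->.
by have := stepT (nx i) 0; rewrite nx3 => ->.
Qed.

(** [rel_gg] moves [g i] past the shift that produces [T i m.+1], at the cost of a [tau] that
    commutes with [T i m] by [C m]. *)
Let A_succ m : A m -> C m -> A m.+1.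
Proof.
move=> Am Cm i; have := stepT (nx i) m; rewrite nx3 => <-.
rewrite -cj_comp (_ : g i * g (nx i) =
  g (nx i) * (tau (T (nx (nx i)) 0) (T (nx (nx i)) 1%N) * g i)); last first.
  by rewrite -stepT /cj -rel_gg // !mulgA mulgV mul1g.
rewrite cj_comp [cj (_ * g i) _]cj_comp Am; congr (cj _ _); apply/cj_commute.
by have := Cm (nx (nx i)); rewrite nx3.
Qed.

Let C_succ m : A 1%N -> B m -> C m -> C m.+1.
Proof.
move=> A1 Bm Cm i; have := commute_cj (g i)^-1 (Cm i).
by rewrite cj_tau (cjV (A0 i)) (cjV (A1 i)) (cjV (Bm i)).
Qed.

Let AC m : A m /\ C m.
Proof.
have A1 : A 1%N by apply: A_succ.
elim: m => [//|m [Am Cm]]; split; first exact: A_succ.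
by apply: C_succ => //; apply: A_B.
Qed.

Lemma star_tr_cj i y : cj (g i) (star_tr y) = star_tr (shift_fun (nx i) (nx (nx i)) y).
Proof.
have n1 : (i == nx i) = false by rewrite eq_sym (negbTE (nx_neq i)).
have n2 : (i == nx (nx i)) = false by rewrite eq_sym (negbTE (nx2_neq i)).
case: y => k m; rewrite /shift_fun /=.
have [->|->|->] := nxP i k.
- by rewrite n1 n2; apply: (AC m).1.
- by rewrite eqxx; case: m => [|m]; [apply: gt|apply: A_B; apply: (AC m).1].
- by rewrite (negbTE (nx_neq _)) eqxx stepT.
Qed.

Lemma star_tr2 y : star_tr y * star_tr y = 1.
Proof.
case: y => i m; rewrite /star_tr /=; elim: m => [|m IHm] /=; first exact: rel_t2.
by rewrite -cjM IHm /cj mulg1 mulgV.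
Qed.

Lemma star_trV y : (star_tr y)^-1 = star_tr y.
Proof. exact: mulg1_eq (star_tr2 y). Qed.
End Relations.

(** * Transitivity of the shifts on triples of points *)

Section Triples.
Variable S : 'I_3 * nat -> 'I_3 * nat -> 'I_3 * nat -> Prop.
Hypotheses (S12 : forall x y z, S x y z -> S y x z).
Hypotheses (S_rot : forall x y z, S x y z -> S y z x).
Hypothesis S_shift : forall p r x y z, p != r -> S x y z ->
  S (shift_fun p r x) (shift_fun p r y) (shift_fun p r z).
Hypothesis S_base : S (p0, 0) (p1, 0) (p2, 0).

Let S23 x y z : S x y z -> S x z y.
Proof. by move=> /S12 /S_rot. Qed.

(* The element [k] stays on prong [q] while one step is moved from prong [p]
   to prong [r]. *)
Let shift_spread p q r i j k : uniq [:: p; q; r] ->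
  S (p, i.+1) (r, j) (q, k) -> S (p, i) (r, j.+1) (q, k).
Proof.
rewrite /= !inE !negb_or => /and3P[/andP[pq pr] qr _].
move=> /(S_shift pr); rewrite /shift_fun /= !eqxx.
by rewrite (eq_sym r p) (negbTE pr) (eq_sym q p) (negbTE pq) (negbTE qr).
Qed.

Let spread_sum i j k : S (p0, 0) (p1, 0) (p2, i + j + k)%N -> S (p0, i) (p1, j) (p2, k).
Proof.
elim: i j k => [|i IHi] j k.
  elim: j k => [//|j IHj] k; rewrite add0n addSnnS => /(IHj k.+1).
  by move/S_rot/S12/(@shift_spread p2 p0 p1 _ _ _ isT)/S_rot/S12.
rewrite !addSn -addnS => /IHi.
by move/S_rot/S_rot/(@shift_spread p2 p1 p0 _ _ _ isT)/S_rot.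
Qed.

Let spread_base k : S (p0, 0) (p1, 0) (p2, k).
Proof.
elim: k => [//|k IHk].
(* Parking the first point on [p1] empties [p0], so a shift from [p0] to [p2] raises [k] alone; the
   last shift undoes the parking. *)
have h : S (p1, 0) (p1, 1%N) (p2, k).
  by move: IHk => /(@S_shift p0 p1 _ _ _ isT); rewrite /shift_fun.
have h' : S (p1, 0) (p1, 1%N) (p2, k.+1).
  by move: h => /(@S_shift p0 p2 _ _ _ isT); rewrite /shift_fun.
by move: h' => /(@S_shift p1 p0 _ _ _ isT); rewrite /shift_fun.
Qed.

Let spread p q r i j k : uniq [:: p; q; r] -> S (p, i) (q, j) (r, k).
Proof.
have h i' j' k' : S (p0, i') (p1, j') (p2, k') by apply/spread_sum/spread_base.
have [->|->|->] := ord3P p; have [->|->|->] := ord3P q;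
  have [->|->|->] := ord3P r => // _.
- exact: S23.
- exact: S12.
- exact: S_rot.
- exact/S_rot/S_rot.
- exact/S12/S_rot.
Qed.

Let third (p q : 'I_3) : p != q -> exists r, uniq [:: p; q; r].
Proof.
by have [->|->|->] := ord3P p; have [->|->|->] := ord3P q => // _;
  [exists p2|exists p1|exists p2|exists p0|exists p1|exists p0].
Qed.

(** A shift from the third prong pushes the origin of that prong onto [p], below the point already
    there. *)
Let two_one p q i j k : p != q -> (i < j)%N -> S (p, i) (p, j) (q, k).
Proof.
move=> pq; have [r u] := third pq; move: (u).
rewrite /= !inE !negb_or => /and3P[/andP[_ pr] qr _].
have [rp rq qp] : [/\ r != p, r != q & q != p] by split; rewrite eq_sym.
elim: i j => [|i IHi] [|j] // ij.
  have /(S_shift rp) : S (r, 0) (p, j) (q, k).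
    by apply: spread; rewrite /= !inE !negb_or rp rq pq.
  by rewrite /shift_fun /= !eqxx (negbTE pr) (negbTE qr) (negbTE qp).
have /(S_shift rp) := IHi j ij.
by rewrite /shift_fun /= !eqxx (negbTE pr) (negbTE qr) (negbTE qp).
Qed.

Let three_one p i j k : (i < j)%N -> (j < k)%N -> S (p, i) (p, j) (p, k).
Proof.
have pr := nx_neq p; have rp : p != nx p by rewrite eq_sym.
elim: i j k => [|i IHi] [|j] [|k] // ij jk.
  have /(S_shift pr) : S (nx p, 0) (p, j) (p, k).
    by apply/S_rot/S_rot/two_one => //; rewrite eq_sym.
  by rewrite /shift_fun /= !eqxx (negbTE rp).
have /(S_shift pr) := IHi j k ij jk.
by rewrite /shift_fun /= !eqxx (negbTE rp).
Qed.

Let same_two p i j z : i != j -> z.1 != p -> S (p, i) (p, j) z.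
Proof.
case: z => q k /= + qp; have pq : p != q by rewrite eq_sym.
by case: ltngtP => // ij _; [apply: two_one|apply/S12/two_one].
Qed.

(** The number of prongs that the three points occupy selects [three_one], [same_two] or
    [spread]. *)
Lemma triple_all x y z : uniq [:: x; y; z] -> S x y z.
Proof.
case: x y z => [p i] [q j] [r k]; rewrite /= !inE !negb_or => /and3P[/andP[xy xz] yz _].
have ne (a b : 'I_3) (c d : nat) : (a, c) != (b, d) -> a = b -> c != d.
  by move=> h e; apply: contra_neq h => ->; rewrite e.
have [epq|npq] := eqVneq p q; have [epr|npr] := eqVneq p r.
- have ij := ne _ _ _ _ xy epq; have ik := ne _ _ _ _ xz epr.
  have jk := ne _ _ _ _ yz (etrans (esym epq) epr); rewrite -epq -epr.
  move: ij ik jk; case: (ltngtP i j) => // ij _; case: (ltngtP i k) => // ik _;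
    case: (ltngtP j k) => // jk _.
  + exact: three_one.
  + exact/S23/three_one.
  + by move: (ltn_trans ij jk); rewrite ltnNge (ltnW ik).
  + exact/S_rot/three_one.
  + exact/S12/three_one.
  + by move: (ltn_trans jk ij); rewrite ltnNge (ltnW ik).
  + exact/S_rot/S_rot/three_one.
  + by apply/S12/S_rot/three_one.
- by rewrite -epq; apply: same_two; [apply: ne xy epq|rewrite /= eq_sym].
- by rewrite -epr; apply/S23/same_two; [apply: ne xz epr|rewrite /= eq_sym].
have [eqr|nqr] := eqVneq q r; last first.
  by apply: spread; rewrite /= !inE !negb_or npq npr nqr.
by rewrite -eqr; apply/S_rot/S_rot/same_two => //; apply: ne yz eqr.
Qed.
End Triples.

(** * Relations among the star transpositions *)

Section StarTranspositions.
Variables (G : groupType) (g t : 'I_3 -> G).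
Hypothesis relG : houghton_rel g t.
Local Notation T := (star_tr g t).
Implicit Types (x y z p q : 'I_3 * nat).

Let R x y z := tau (T x) (T y) = tau (T y) (T x) /\ commute (tau (T x) (T y)) (T z).
Let S x y z := [/\ R x y z, R y z x & R z x y].

Let R_sym x y z : R x y z -> R y x z.
Proof. by case=> b c; split; rewrite // -b. Qed.

Let R_tr a f x y z : (forall w, cj a (T w) = T (f w)) -> R x y z -> R (f x) (f y) (f z).
Proof.
move=> af [b c]; rewrite /R -!af -!cj_tau; split; first by rewrite b.
exact: commute_cj.
Qed.

Let S_tr a f x y z : (forall w, cj a (T w) = T (f w)) -> S x y z -> S (f x) (f y) (f z).
Proof. by move=> af [r1 r2 r3]; split; apply: (R_tr af). Qed.

Lemma star_tr_shift (p r : 'I_3) : p != r ->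
  exists a, forall y, cj a (T y) = T (shift_fun p r y).
Proof.
move=> pr; case: (nxP p r) => e.
- by rewrite e eqxx in pr.
- exists (g (nx (nx p))) => y; rewrite (star_tr_cj relG) nx3; congr T.
  by rewrite e.
exists (g (nx p))^-1 => y; apply: cjV; rewrite (star_tr_cj relG) nx3; congr T.
by rewrite -e shift_funK.
Qed.

Let S_all x y z : uniq [:: x; y; z] -> S x y z.
Proof.
apply: triple_all.
- by move=> {}x {}y {}z [r1 r2 r3]; split; apply: R_sym.
- by move=> {}x {}y {}z [].
- by move=> p r {}x {}y {}z /star_tr_shift[a af]; apply: S_tr af.
have r i : R (i, 0) (nx i, 0) (nx (nx i), 0).
  by split; [apply: (rel_braid relG)|apply: (rel_triple relG)].
by split; [apply: (r p0)|apply: (r p1)|apply: (r p2)].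
Qed.

Lemma star_braid x y : x != y -> tau (T x) (T y) = tau (T y) (T x).
Proof.
move=> xy; have inj : injective (fun m => (p0, m) : 'I_3 * nat) by move=> m m' [].
have [k nk] := fresh [:: x; y] inj.
by have [_ []] : S (p0, k) x y by apply: S_all; rewrite /= nk !inE xy.
Qed.

Lemma star_comm x y z : uniq [:: x; y; z] -> commute (tau (T x) (T y)) (T z).
Proof. by move/S_all=> [[]]. Qed.

Definition star_prod (s : seq ('I_3 * nat)) : G := \prod_(y <- s) T y.

Lemma star_prod_cons x s : star_prod (x :: s) = T x * star_prod s.
Proof. by rewrite /star_prod big_cons. Qed.

Lemma star_prod_cat s s' : star_prod (s ++ s') = star_prod s * star_prod s'.
Proof. by rewrite /star_prod big_cat. Qed.

Let T2 x : T x * T x = 1. Proof. exact: star_tr2. Qed.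
Let TK x a : T x * (T x * a) = a. Proof. by rewrite mulgA T2 mul1g. Qed.

(* Coset decomposition over the stabiliser of [p]: the extra factor sends [p] to
   [p], to the base point, or to [q]. *)
Lemma star_normal p F s : p \notin F -> {subset s <= p :: F} ->
  exists2 s', {subset s' <= F} &
    [\/ star_prod s = star_prod s', star_prod s = T p * star_prod s' |
      exists2 q, q \in F & star_prod s = tau (T p) (T q) * star_prod s'].
Proof.
move=> pF; elim: s => [_|x s IHs sF].
  by exists [::] => //; apply: Or31.
have [|s' s'F] := IHs; first by move=> y ys; apply: sF; rewrite inE ys orbT.
have cons y : y \in F -> {subset y :: s' <= F}.
  by move=> yF z; rewrite inE => /orP[/eqP ->//|]; apply: s'F.
have := sF x (mem_head _ _); rewrite star_prod_cons inE => /orP[/eqP -> {sF}|xF].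
  case=> [->|->|[q qF ->]].
  - by exists s' => //; apply: Or32.
  - by exists s'; rewrite ?TK //; apply: Or31.
  exists (q :: s'); first exact: cons.
  apply: Or33; exists q => //; rewrite star_prod_cons {2}star_braid.
    by rewrite /tau -!mulgA !TK.
  by apply: contraNneq pF => ->.
have px : p != x by apply: contraNneq pF => ->.
case=> [->|->|[q qF ->]].
- exists (x :: s'); first exact: cons.
  by apply: Or31; rewrite star_prod_cons.
- exists (x :: s'); first exact: cons.
  apply: Or33; exists x => //; rewrite star_braid // star_prod_cons.
  by rewrite /tau -!mulgA TK.
exists (x :: s'); first exact: cons.
have [exq|nxq] := eqVneq x q.
  apply: Or32; rewrite star_prod_cons -exq star_braid //.
  by rewrite /tau -!mulgA TK.
have com : T x * tau (T p) (T q) = tau (T p) (T q) * T x.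
  have pq : p != q by apply: contraNneq pF => ->.
  by apply/esym/star_comm; rewrite /= !inE !negb_or px pq (eq_sym q) nxq.
apply: Or33; exists q => //.
by rewrite star_prod_cons (mulgA (T x)) com -(mulgA (tau _ _)).
Qed.

Definition star : 'I_3 * nat := (p0, 0).
(** Identifies the abstract prongs with the complement of [star] by moving [p0] one step
    outwards. *)
Definition off_star (y : 'I_3 * nat) : 'I_3 * nat :=
  if y.1 == p0 then (p0, y.2.+1) else y.

Lemma off_star_inj : injective off_star.
Proof.
move=> [i m] [j k]; rewrite /off_star /=.
have [ei|ni] := eqVneq i p0; have [ej|nj] := eqVneq j p0 => //.
- by case=> ->; rewrite ei ej.
- by case=> e; rewrite -e eqxx in nj.
- by case=> e; rewrite e eqxx in ni.
Qed.

Lemma off_star_neq y : off_star y != star.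
Proof.
case: y => i m; rewrite /off_star /star /=.
have [_|ni] := eqVneq i p0; first by [].
by apply: contraNneq ni => -[->].
Qed.

Lemma off_starP x : x = star \/ exists y, x = off_star y.
Proof.
case: x => i m; have [->|ni] := eqVneq i p0.
  by case: m => [|m]; [left|right; exists (p0, m)].
by right; exists (i, m); rewrite /off_star /= (negbTE ni).
Qed.

Variable pi : G -> houghton 3.
Hypotheses (piM : {morph pi : a b / a * b}) (pi1 : pi 1 = 1).
Hypothesis piT : forall y, pi (T y) = htr star (off_star y).

Let piT_off x y : x != y -> pi (T x) (off_star y) = off_star y.
Proof.
move=> xy; rewrite piT; apply: trD; first exact: off_star_neq.
by rewrite (inj_eq off_star_inj) eq_sym.
Qed.

Let piT_self x : pi (T x) (off_star x) = star.
Proof. by rewrite piT; apply: trr. Qed.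

Let piT_star x : pi (T x) star = off_star x.
Proof. by rewrite piT; apply: trl. Qed.

Let pi_prod_fix p s : p \notin s -> pi (star_prod s) (off_star p) = off_star p.
Proof.
elim: s => [|x s IHs]; first by rewrite /star_prod big_nil pi1.
rewrite inE negb_or star_prod_cons piM => /andP[px ps].
by rewrite hM IHs // piT_off // eq_sym.
Qed.

(** Points are removed from [F] one at a time. In the last two cases of [star_normal] the image of
    [off_star p] is [star] or [off_star q], so a product with trivial image falls in the first
    case. *)
Lemma star_prod_faithful s : pi (star_prod s) = 1 -> star_prod s = 1.
Proof.
have [F sF] : exists F : seq ('I_3 * nat), {subset s <= F} by exists s.
elim: F s sF => [|p F IHF] s sF pis.
  case: s sF {pis} => [|x s sF]; first by rewrite /star_prod big_nil.
  by have := sF x (mem_head _ _).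
have [pF|pF] := boolP (p \in F).
  by apply: IHF pis => y /sF; rewrite inE => /orP[/eqP ->|].
have [s' s'F] := star_normal pF sF.
have fixp : pi (star_prod s') (off_star p) = off_star p.
  by apply: pi_prod_fix; apply: contraNN pF => /s'F.
have pisp : pi (star_prod s) (off_star p) = off_star p by rewrite pis h1.
case=> [e|e|[q qF e]]; first by rewrite e in pis *; apply: IHF pis.
  have := off_star_neq p; rewrite -{1}pisp e piM hM fixp piT_self.
  by rewrite eqxx.
have pq : p != q by apply: contraNneq pF => ->.
have := pisp; rewrite e /tau !piM !hM fixp piT_self piT_star piT_off //.
by move=> /off_star_inj eq; rewrite eq eqxx in pq.
Qed.
End StarTranspositions.

(** * Translation lengths *)

Section TranslationLength.
Implicit Types (f g : houghton 3) (i : 'I_3).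

Definition is_tl f (t : 'I_3 -> int) := forall i, exists N, forall m, (N <= m)%N ->
  (f (i, m)).1 = i /\ ((f (i, m)).2%:Z = m%:Z + t i :> int)%R.

Lemma is_tl_exists f : exists t, is_tl f t.
Proof. by have /asboolP : val f \in @is_houghton 3 by apply: valP. Qed.

Definition tl f : 'I_3 -> int := projT1 (cid (is_tl_exists f)).

Lemma tlP f : is_tl f (tl f).
Proof. by rewrite /tl; case: cid. Qed.

Lemma tlE f t i : is_tl f t -> tl f i = t i.
Proof.
move=> /(_ i)[N hN]; have [M fM] := tlP f i.
by have [_] := hN _ (leq_addr M N); have [_] := fM _ (leq_addl N M); lia.
Qed.

Lemma tl_far f i : exists N, forall m (k : nat), (N <= m)%N ->
  (m%:Z + tl f i = k%:Z)%R -> f (i, m) = (i, k).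
Proof.
have [N hN] := tlP f i; exists N => m k /hN[e1 e2] e.
by rewrite [LHS]surjective_pairing e1; congr (_, _); lia.
Qed.

Lemma tlM f g i : tl (f * g) i = (tl f i + tl g i)%R.
Proof.
apply: (@tlE _ (fun i => tl f i + tl g i)%R) => {}i.
have [N fN] := tl_far f i; have [M gM] := tl_far g i.
exists (N + M + `|tl f i| + `|tl g i|)%N => m le_m.
rewrite hM (gM m `|(m%:Z + tl g i)%R|%N); try lia.
rewrite (fN _ `|(m%:Z + tl g i + tl f i)%R|%N); try lia.
by split=> //=; lia.
Qed.

Lemma tl1 i : tl 1 i = 0%R.
Proof.
by apply: (@tlE _ (fun=> 0%R)) => {}i; exists 0%N => m _; rewrite h1 addr0.
Qed.

Lemma tl_htr x y i : tl (htr x y) i = 0%R.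
Proof.
apply: (@tlE _ (fun=> 0%R)) => {}i; exists (x.2 + y.2).+1 => m le_m.
rewrite [htr _ _ _]trD; first by rewrite addr0.
  by apply: contraTneq le_m => <- /=; lia.
by apply: contraTneq le_m => <- /=; lia.
Qed.
End TranslationLength.

Section ZPower.
Variable G : groupType.
Implicit Types x y : G.

Definition zpow x (z : int) : G :=
  match z with Posz n => x ^+ n | Negz n => x^-1 ^+ n.+1 end.

Lemma zpowS x z : zpow x (z + 1)%R = x * zpow x z.
Proof.
case: z => [n|[|n]].
- by rewrite (_ : (n%:Z + 1)%R = n.+1) ?[LHS]expgS //; lia.
- by rewrite (_ : (Negz 0 + 1)%R = 0%N) // [zpow x (Negz 0)]/= mulgV.
- rewrite (_ : (Negz n.+1 + 1)%R = Negz n); last by lia.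
  by rewrite [RHS]/= [_^-1 ^+ n.+2]expgS mulVKg.
Qed.

Lemma zpowB1 x z : zpow x (z - 1)%R = x^-1 * zpow x z.
Proof. by rewrite -{2}[z](subrK 1%R) zpowS mulKg. Qed.

Variables (M : G -> int).
Hypothesis MM : forall x y, M (x * y) = (M x + M y)%R.

Let M1 : M 1 = 0%R.
Proof. by have := MM 1 1; rewrite mulg1; lia. Qed.

Lemma additiveV x : M x^-1 = (- M x)%R.
Proof. by have := MM x x^-1; rewrite mulgV M1; lia. Qed.

Lemma additive_zpow x z : M (zpow x z) = (z * M x)%R.
Proof.
have MX y n : M (y ^+ n) = (n%:Z * M y)%R.
  elim: n => [|n IHn]; first by rewrite expg0 M1 mul0r.
  by rewrite expgS MM IHn (_ : n.+1%:Z = 1 + n%:Z :> int)%R ?mulrDl ?mul1r.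
by case: z => n; rewrite /zpow MX // additiveV NegzE mulrN mulNr.
Qed.
End ZPower.

(** * Normal forms modulo the star transpositions *)

Section NormalForm.
Variables (G : groupType) (g t : 'I_3 -> G).
Hypothesis relG : houghton_rel g t.
Local Notation T := (star_tr g t).
Local Notation prod_T := (star_prod g t).

Definition in_core (n : G) := exists s, n = prod_T s.

Let core1 : in_core 1. Proof. by exists [::]; rewrite /star_prod big_nil. Qed.

Let coreM m n : in_core m -> in_core n -> in_core (m * n).
Proof. by move=> [s ->] [s' ->]; exists (s ++ s'); rewrite star_prod_cat. Qed.

Let coreT y : in_core (T y).
Proof. by exists [:: y]; rewrite /star_prod big_seq1. Qed.

Let coreV n : in_core n -> in_core n^-1.
Proof.
move=> [s ->]; elim: s => [|y s IHs]; first by rewrite /star_prod big_nil invg1.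
by rewrite star_prod_cons invgM star_trV //; apply: coreM.
Qed.

Let norm_core a := forall n, in_core n -> in_core (cj a n).

Let norm_of a f : (forall y, cj a (T y) = T (f y)) -> norm_core a.
Proof.
move=> af n [s ->]; elim: s => [|y s IHs].
  by rewrite /star_prod big_nil /cj mulg1 mulgV.
by rewrite star_prod_cons cjM af; apply: coreM.
Qed.

Let norm_g i : norm_core (g i).
Proof. by apply: norm_of => y; apply: star_tr_cj. Qed.

Let norm_gV i : norm_core (g i)^-1.
Proof.
apply: (@norm_of _ (shift_fun (nx (nx i)) (nx i))) => y; apply: cjV.
by rewrite star_tr_cj // shift_funK // nx_neq.
Qed.

Let norm1 : norm_core 1. Proof. by move=> n; rewrite cj1. Qed.

Let normM a b : norm_core a -> norm_core b -> norm_core (a * b).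
Proof. by move=> na nb n /nb/na; rewrite cj_comp. Qed.

(** Commutation modulo the subgroup [in_core], which the [g i] normalise. *)
Let comm_mod x y := exists2 n, in_core n & x * y = n * (y * x).

Let comm_mod_sym x y : comm_mod x y -> comm_mod y x.
Proof.
move=> [n Nn e]; exists n^-1; first exact: coreV.
by rewrite e mulKg.
Qed.

Let comm_modM x y z : norm_core y -> comm_mod x y -> comm_mod x z -> comm_mod x (y * z).
Proof.
move=> Ny [n Nn e] [n' Nn' e']; exists (n * cj y n').
  by apply: coreM => //; apply: Ny.
by rewrite mulgA e -mulgA -mulgA e' /cj !mulgA mulgVK.
Qed.

Let comm_modV x y : norm_core y^-1 -> comm_mod x y -> comm_mod x y^-1.
Proof.
move=> Ny [n Nn e]; exists (cj y^-1 n^-1); first by apply/Ny/coreV.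
rewrite /cj invgK; apply: (mulIg y); rewrite mulgVK -!mulgA mulVKg e.
by rewrite mulKg mulKg.
Qed.

Let comm_mod_zpow x i z : comm_mod x (g i) -> comm_mod x (zpow (g i) z).
Proof.
have h y n : norm_core y -> comm_mod x y -> norm_core (y ^+ n) /\ comm_mod x (y ^+ n).
  move=> Ny c; elim: n => [|n [Nyn cn]]; rewrite ?expg0 ?expgS.
    by split=> //; exists 1 => //; rewrite mulg1 !mul1g.
  by split; [apply: normM|apply: comm_modM].
move=> c; case: z => n; first by case: (h _ n (@norm_g i) c).
by case: (h _ n.+1 (@norm_gV i)) => //; apply: comm_modV.
Qed.

Let comm_g01 : comm_mod (g p0) (g p1).
Proof.
exists (cj (g p1) (tau (T (p2, 0)) (cj (g p0) (T (p2, 0))))).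
  rewrite star_tr_cj //; apply: norm_g; rewrite /tau.
  by apply: coreM; [apply: coreM|].
rewrite /cj -(mulgA _ _ (g p1 * _)) mulKg -mulgA.
by rewrite -(rel_gg relG p0) !mulgA mulgV mul1g.
Qed.

Let comm_g10 : comm_mod (g p1) (g p0). Proof. exact: comm_mod_sym. Qed.

Let comm_gV10 : comm_mod (g p1)^-1 (g p0).
Proof. by apply/comm_mod_sym/comm_modV. Qed.

Definition normal_form (x : G) := exists n a b,
  in_core n /\ x = n * (zpow (g p0) a * zpow (g p1) b).

Let nf_core m x : in_core m -> normal_form x -> normal_form (m * x).
Proof.
move=> Nm [n [a [b [Nn ->]]]]; exists (m * n), a, b.
by rewrite mulgA; split=> //; apply: coreM.
Qed.

Let nf_cj y x : norm_core y ->
  (forall a b, normal_form (y * (zpow (g p0) a * zpow (g p1) b))) ->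
  normal_form x -> normal_form (y * x).
Proof.
move=> Ny h [n [a [b [Nn ->]]]].
rewrite (_ : y * _ = cj y n * (y * (zpow (g p0) a * zpow (g p1) b))).
  by apply: nf_core => //; apply: Ny.
by rewrite /cj !mulgA mulgVK.
Qed.

Let nf_g0 x : normal_form x -> normal_form (g p0 * x).
Proof.
apply: nf_cj => // a b; exists 1, (a + 1)%R, b.
by rewrite zpowS mul1g mulgA.
Qed.

Let nf_g0V x : normal_form x -> normal_form ((g p0)^-1 * x).
Proof.
apply: nf_cj => // a b; exists 1, (a - 1)%R, b.
by rewrite zpowB1 mul1g mulgA.
Qed.

Let nf_g1 x : normal_form x -> normal_form (g p1 * x).
Proof.
apply: nf_cj => // a b; have [n Nn e] := comm_mod_zpow a comm_g10.
by exists n, a, (b + 1)%R; rewrite zpowS mulgA e -!mulgA.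
Qed.

Let nf_g1V x : normal_form x -> normal_form ((g p1)^-1 * x).
Proof.
apply: nf_cj => // a b; have [n Nn e] := comm_mod_zpow a comm_gV10.
by exists n, a, (b - 1)%R; rewrite zpowB1 mulgA e -!mulgA.
Qed.

Let g2E : g p2 = (g p0)^-1 * (g p1)^-1.
Proof.
rewrite -invgM; apply: (mulgI (g p1 * g p0)); rewrite mulgV.
exact: (rel_ggg relG p0).
Qed.

Lemma normal_form1 : normal_form 1.
Proof. by exists 1, 0%R, 0%R; rewrite /= !expg0 !mulg1. Qed.

Lemma normal_form_g i x : normal_form x -> normal_form (g i * x).
Proof.
move=> nx_; have [->|->|->] := ord3P i; [exact: nf_g0|exact: nf_g1|].
by rewrite g2E -mulgA; apply/nf_g0V/nf_g1V.
Qed.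

Lemma normal_form_gV i x : normal_form x -> normal_form ((g i)^-1 * x).
Proof.
move=> nx_; have [->|->|->] := ord3P i; [exact: nf_g0V|exact: nf_g1V|].
by rewrite g2E invgM !invgK -mulgA; apply/nf_g1/nf_g0.
Qed.

Lemma normal_form_t i x : normal_form x -> normal_form (t i * x).
Proof. by apply: nf_core; apply: (coreT (i, 0)). Qed.

Lemma normal_form_tV i x : normal_form x -> normal_form ((t i)^-1 * x).
Proof. by apply: nf_core; apply/coreV/(coreT (i, 0)). Qed.

Variable pi : G -> houghton 3.
Hypotheses (piM : {morph pi : a b / a * b}) (pi1 : pi 1 = 1).
Hypothesis piT : forall y, pi (T y) = htr star (off_star y).
Hypothesis pi_tl : forall i k, tl (pi (g i)) k =
  if k == nx i then (- 1)%R else if k == nx (nx i) then 1%R else 0%R.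

Lemma normal_form_faithful x : normal_form x -> pi x = 1 -> x = 1.
Proof.
move=> [n [a [b [[s ->] ->]]]] pix.
pose M k y := tl (pi y) k.
have MM k y z : M k (y * z) = (M k y + M k z)%R by rewrite /M piM tlM.
have Mn k : M k (prod_T s) = 0%R.
  elim: s {pix} => [|y s IHs]; first by rewrite /star_prod big_nil /M pi1 tl1.
  by rewrite star_prod_cons MM IHs {1}/M piT tl_htr.
have Mx k : (a * tl (pi (g p0)) k + b * tl (pi (g p1)) k = 0)%R.
  have : M k (prod_T s * (zpow (g p0) a * zpow (g p1) b)) = 0%R by rewrite /M pix tl1.
  by rewrite !MM Mn !additive_zpow // add0r.
(* On [p1] only [g p0] has non-zero translation length, which kills [a]; then [p2] kills [b]. *)
have a0 : a = 0%R by have := Mx p1; rewrite !pi_tl /=; lia.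
have b0 : b = 0%R by have := Mx p2; rewrite !pi_tl /=; lia.
move: pix; rewrite a0 b0 /= !expg0 !mulg1; exact: star_prod_faithful.
Qed.
End NormalForm.

(** * Words and the universal property of a presentation *)

Section Words.
Variables (n : nat) (rels : seq (word n)).
Implicit Types (u v w r : word n) (a : 'I_n * bool).

Definition linv a := (a.1, ~~ a.2).
Definition winv w : word n := rev (map linv w).

Lemma linvK : involutive linv.
Proof. by case=> i e; rewrite /linv /= negbK. Qed.

Lemma winv_cons a w : winv (a :: w) = rcons (winv w) (linv a).
Proof. by rewrite /winv /= rev_cons. Qed.

Section Eval.
Variables (G : groupType) (x : 'I_n -> G).

Lemma word_eval_nil : word_eval x [::] = 1.
Proof. by rewrite /word_eval big_nil. Qed.

Lemma word_eval_cons a w :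
  word_eval x (a :: w) = (if a.2 then (x a.1)^-1 else x a.1) * word_eval x w.
Proof. by rewrite /word_eval big_cons. Qed.

Lemma word_eval_cat u v : word_eval x (u ++ v) = word_eval x u * word_eval x v.
Proof. by rewrite /word_eval big_cat. Qed.

Lemma word_evalV w : word_eval x (winv w) = (word_eval x w)^-1.
Proof.
elim: w => [|[i e] w IHw]; first by rewrite word_eval_nil invg1.
rewrite winv_cons -cats1 word_eval_cat IHw !word_eval_cons word_eval_nil mulg1.
by rewrite invgM; case: e; rewrite /= ?invgK.
Qed.

Lemma word_eq_eval u v : (forall r, r \in rels -> word_eval x r = 1) ->
  word_eq rels u v -> word_eval x u = word_eval x v.
Proof.
move=> x1; elim=> {u v} [//|u v _ ->//|u v w _ -> _ ->//|u v i e|u v r /x1 r1].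
  rewrite !word_eval_cat !word_eval_cons word_eval_nil mulg1; congr (_ * _).
  by case: e; rewrite /= ?mulVg ?mulgV mul1g.
by rewrite !word_eval_cat r1 mul1g.
Qed.
End Eval.

Lemma word_eq_catl w u v : word_eq rels u v -> word_eq rels (w ++ u) (w ++ v).
Proof.
elim=> {u v} [u|u v _ IH|u v z _ IH1 _ IH2|u v i e|u v r rr].
- exact: word_eq_refl.
- exact: word_eq_sym.
- exact: word_eq_trans IH1 IH2.
- by rewrite !(catA w); apply: word_eq_cancel.
- by rewrite !(catA w); apply: word_eq_rel.
Qed.

Lemma word_eq_winvl w u : word_eq rels (winv w ++ w ++ u) u.
Proof.
elim: w u => [|a w IHw] u; first exact: word_eq_refl.
rewrite winv_cons -cats1 -catA; apply: word_eq_trans (IHw u).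
apply: word_eq_catl; case: a => i e.
by have := word_eq_cancel rels [::] (w ++ u) i (~~ e); rewrite negbK.
Qed.

Lemma winvK : involutive winv.
Proof. by move=> w; rewrite /winv map_rev revK (mapK linvK). Qed.

Lemma word_eq_winvr w u : word_eq rels (w ++ winv w ++ u) u.
Proof. by rewrite -{1}(winvK w); apply: word_eq_winvl. Qed.

(* The presented group is realised by left translations of the sets of words that
   are unions of classes of [word_eq]. *)
Definition saturated (C : set (word n)) := forall u v, word_eq rels u v -> C u -> C v.

Let wset := {C : set (word n) | saturated C}.

Let wset_ext (C D : wset) : (forall u, sval C u <-> sval D u) -> C = D.
Proof.
case: C D => [C sC] [D sD] /= CD; have e : C = D by apply/seteqP; split=> u /CD.
by rewrite e in sC *; rewrite (Prop_irrelevance sC sD).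
Qed.

Let lact_sat a (C : wset) : saturated [set u | sval C (linv a :: u)].
Proof.
move=> u v uv /=; case: C => C sC /=; apply: sC.
by have := word_eq_catl [:: linv a] uv.
Qed.

Let lact a (C : wset) : wset := exist _ _ (@lact_sat a C).

Let lactK a : cancel (lact a) (lact (linv a)).
Proof.
move=> C; apply: wset_ext => u /=; rewrite linvK; case: C => C sC /=; case: a => i e.
by have := word_eq_cancel rels [::] u i (~~ e); rewrite /= negbK /linv /= => h;
  split; apply: sC => //; apply: word_eq_sym.
Qed.

Let lactVK a : cancel (lact (linv a)) (lact a).
Proof. by move=> C; rewrite -{1}(linvK a) lactK. Qed.

Let lperm a : sym wset := Sym (Bijective (@lactK a) (@lactVK a)).

Let lgen i := lperm (i, false).

Let lgenE a : (if a.2 then (lgen a.1)^-1 else lgen a.1) = lperm a.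
Proof.
case: a => i [] //=; apply: sym_ext => C; rewrite -{1}(@lactVK (i, false) C).
exact: symVK.
Qed.

Let eval_lgen w C u : sval (word_eval lgen w C) u <-> sval C (winv w ++ u).
Proof.
elim: w u => [|a w IHw] u; first by rewrite word_eval_nil.
by rewrite word_eval_cons lgenE symME /= IHw winv_cons cat_rcons.
Qed.

Let eval_rels r : r \in rels -> word_eval lgen r = 1.
Proof.
move=> rr; apply: sym_ext => C; apply: wset_ext => u; rewrite eval_lgen sym1E.
have e : word_eq rels (winv r ++ u) u.
  apply: word_eq_trans (word_eq_winvl r u); apply/word_eq_sym/word_eq_catl.
  exact: (word_eq_rel [::]).
by case: C => C sC /=; split; apply: sC => //; apply: word_eq_sym.
Qed.

Let base_sat : saturated [set u | word_eq rels [::] u].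
Proof. by move=> u v uv /= h; apply: word_eq_trans uv. Qed.

(** The hypothesis is applied to the permutations [lgen]; evaluating on the class of the empty word
    recovers [word_eq]. *)
Lemma word_eq_universal u v :
  (forall (K : groupType) (y : 'I_n -> K),
     (forall r, r \in rels -> word_eval y r = 1) -> word_eval y u = word_eval y v) ->
  word_eq rels u v.
Proof.
move=> /(_ _ lgen eval_rels) e; pose C : wset := exist _ _ base_sat.
have : sval (word_eval lgen u C) u.
  apply/eval_lgen; apply: word_eq_sym; have := word_eq_winvl u [::].
  by rewrite cats0.
rewrite e => /eval_lgen /= h; apply: word_eq_sym.
apply: word_eq_trans (word_eq_winvr v u).
by have := word_eq_catl v h; rewrite cats0.
Qed.
End Words.

(** Completeness of the relators is reduced to computations in an arbitrary group [K] that satisfies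
    them. *)
Lemma presentation_criterion (G : groupType) n (x : 'I_n -> G) (rels : seq (word n)) :
  (forall g, exists w, word_eval x w = g) ->
  (forall r, r \in rels -> word_eval x r = 1) ->
  (forall (K : groupType) (y : 'I_n -> K),
     (forall r, r \in rels -> word_eval y r = 1) ->
     forall w, word_eval x w = 1 -> word_eval y w = 1) ->
  finitely_presented G.
Proof.
move=> gen x1 ker; exists n, x, rels; split=> // u v; split; last exact: word_eq_eval.
move=> xuv; apply: word_eq_universal => K y y1.
have := ker K y y1 (u ++ winv v); rewrite !word_eval_cat !word_evalV xuv mulgV.
by move=> /(_ erefl) /divg1_eq.
Qed.

(** * Shifts that fix the base point *)

Section Lift.
Implicit Types (f : 'I_3 * nat -> 'I_3 * nat) (x y : 'I_3 * nat) (i k : 'I_3).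

(** The conjugate of [f] by [off_star], extended by fixing [star]. *)
Definition lift_fun f x : 'I_3 * nat :=
  if x.1 == p0 then (if x.2 is m.+1 then off_star (f (p0, m)) else star)
  else off_star (f x).

Lemma lift_off f y : lift_fun f (off_star y) = off_star (f y).
Proof.
case: y => k m; have [->//|nk] := eqVneq k p0.
have -> : off_star (k, m) = (k, m) by rewrite /off_star /= (negbTE nk).
by rewrite /lift_fun /= (negbTE nk).
Qed.
Lemma lift_funK f f' : cancel f f' -> cancel (lift_fun f) (lift_fun f').
Proof. by move=> fK x; case: (off_starP x) => [->|[y ->]] //; rewrite !lift_off fK. Qed.

Lemma nx_nx2 i : nx i != nx (nx i). Proof. by rewrite eq_sym nx_neq. Qed.
Lemma nx2_nx i : nx (nx i) != nx i. Proof. exact: nx_neq. Qed.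

Definition lift_shift i : sym ('I_3 * nat) :=
  Sym (Bijective (lift_funK (shift_funK (nx_nx2 i))) (lift_funK (shift_funK (nx2_nx i)))).

Definition shift_tl i k : int :=
  if k == nx i then (- 1)%R else if k == nx (nx i) then 1%R else 0%R.

Lemma off_starE k m : off_star (k, m) = (k, (k == p0) + m)%N.
Proof. by rewrite /off_star /=; case: eqVneq => [->|]. Qed.

Lemma lift_shift_far i k : exists N, forall m, (N <= m)%N ->
  (lift_shift i (k, m)).1 = k /\
  ((lift_shift i (k, m)).2%:Z = m%:Z + shift_tl i k :> int)%R.
Proof.
(* Height 2 keeps the point off the origin of its prong once [off_star] is undone, also on [p0]. *)
exists 2 => m m2.
have -> : (k, m) = off_star (k, m - (k == p0))%N.
  by rewrite off_starE subnKC //; case: (k == p0); lia.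
rewrite [lift_shift i _]lift_off /shift_fun /shift_tl /=.
case: (eqVneq k (nx i)) => [ek|nk].
  case e: (m - (k == p0))%N => [|m'] /=; rewrite !off_starE -?ek /=;
    by split=> //; move: e; case: (k == p0) => /=; lia.
by case: (eqVneq k (nx (nx i))) => [ek|nk'] /=; rewrite !off_starE -?ek /=;
  split=> //; case: (k == p0) => /=; lia.
Qed.

Lemma lift_shift_ev i : eventually_translation (lift_shift i).
Proof. by exists (shift_tl i) => k; apply: lift_shift_far. Qed.
End Lift.

(** * Generators of the Houghton group *)

Section HoughtonGenerators.
Implicit Types (x y : 'I_3 * nat) (i k : 'I_3) (f : houghton 3).

Definition gH i : houghton 3 := hou (lift_shift_ev i).
Definition tH i : houghton 3 := htr star (off_star (i, 0)).

Lemma gH_off i y : gH i (off_star y) = off_star (shift_fun (nx i) (nx (nx i)) y).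
Proof. exact: lift_off. Qed.

Lemma gH_star i : gH i star = star. Proof. by []. Qed.

Lemma houghton_off_ext f f' : f star = f' star ->
  (forall y, f (off_star y) = f' (off_star y)) -> f = f'.
Proof.
by move=> e h; apply: houghton_ext => x; case: (off_starP x) => [->|[y ->]].
Qed.

Lemma tl_gH i k : tl (gH i) k = shift_tl i k.
Proof. by apply: tlE => {}k; apply: lift_shift_far. Qed.

Lemma htr2 x y : htr x y * htr x y = 1.
Proof. by apply/val_inj; apply: tr2. Qed.

Lemma htrl x y : htr x y x = y. Proof. exact: trl. Qed.

Lemma htrr x y : htr x y y = x. Proof. exact: trr. Qed.

Lemma htrD x y z : z != x -> z != y -> htr x y z = z. Proof. exact: trD. Qed.

Lemma htr_off x y z : htr (off_star x) (off_star y) (off_star z) =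
  off_star (tr x y z).
Proof.
rewrite /= /tr_fun !(inj_eq off_star_inj).
by case: (z == x); case: (z == y).
Qed.

Lemma tau_htr x y : x != y ->
  tau (htr star (off_star x)) (htr star (off_star y)) = htr (off_star x) (off_star y).
Proof.
move=> xy; set a := htr star (off_star x).
have aV : a^-1 = a by apply: mulg1_eq; apply: htr2.
rewrite /tau -{2}aV htrJ /a htrl htrD //; first exact: off_star_neq.
by rewrite (inj_eq off_star_inj) eq_sym.
Qed.

Lemma htr_sym x y : htr x y = htr y x.
Proof. by apply/val_inj; apply: tr_sym. Qed.

Lemma gtHJ i x : gH i * htr star (off_star x) * (gH i)^-1 =
  htr star (off_star (shift_fun (nx i) (nx (nx i)) x)).
Proof. by rewrite htrJ gH_star gH_off. Qed.

Lemma houghton_relH : houghton_rel gH tH.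
Proof.
have neq i m j : i != j -> (i, m) != (j, m) :> 'I_3 * nat.
  by move=> ij; apply: contraNneq ij => -[->].
have disj i : ((nx (nx i), 0) != (i, 0)) && ((nx (nx i), 0) != (nx i, 0)).
  by rewrite !neq ?nx_neq ?nx2_neq.
split=> i.
- rewrite gtHJ; congr (htr _ (off_star _)).
  by rewrite /shift_fun /= eqxx.
- rewrite gtHJ; congr (htr _ (off_star _)); rewrite /shift_fun /=.
  by rewrite !(eq_sym i) (negbTE (nx_neq i)) (negbTE (nx2_neq i)).
- apply: houghton_off_ext => // -[k m]; rewrite !hM h1 !gH_off; congr off_star.
  by have [->|->|->] := ord3P i; have [->|->|->] := ord3P k; case: m.
- rewrite gtHJ tau_htr; last first.
    by rewrite /shift_fun /= (negbTE (nx_neq _)) eqxx; apply/eqP => -[].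
  apply: (mulgI (gH (nx i))); rewrite !mulgA mulgV mul1g.
  apply: houghton_off_ext => [|[k m]]; rewrite !hM ?gH_star.
    by rewrite [htr _ _ star]htrD // eq_sym off_star_neq.
  rewrite !gH_off htr_off gH_off; congr off_star.
  by have [->|->|->] := ord3P i; have [->|->|->] := ord3P k; case: m => [|[|m]].
- exact: htr2.
- by rewrite !tau_htr ?neq ?nx_neq // 1?eq_sym ?nx_neq // htr_sym.
rewrite tau_htr ?neq //; last by rewrite eq_sym nx_neq.
apply: (mulIg (htr (off_star (i, 0)) (off_star (nx i, 0)))^-1).
have /andP[d1 d2] := disj i; rewrite htrJ mulgK htrD 1?eq_sym ?off_star_neq //.
by rewrite htrD // (inj_eq off_star_inj).
Qed.

Lemma star_tr_gH y : star_tr gH tH y = htr star (off_star y).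
Proof.
case: y => i m; rewrite /star_tr /=; elim: m => [//|m IHm] /=.
rewrite IHm /cj gtHJ nx3; congr (htr _ (off_star _)).
by rewrite /shift_fun /= eq_sym (negbTE (nx2_neq i)) eqxx.
Qed.

Section FaithfulPair.
Variables (K : groupType) (g t : 'I_3 -> K).
Hypothesis relK : houghton_rel g t.
Let gK i : K * houghton 3 := (g i, gH i).
Let tK i : K * houghton 3 := (t i, tH i).

Let relKH : houghton_rel gK tK.
Proof.
by split=> i; congr (_, _);
  [apply: (rel_gt relK)|apply: (rel_gt houghton_relH)
  |apply: (rel_fix relK)|apply: (rel_fix houghton_relH)
  |apply: (rel_ggg relK)|apply: (rel_ggg houghton_relH)
  |apply: (rel_gg relK)|apply: (rel_gg houghton_relH)
  |apply: (rel_t2 relK)|apply: (rel_t2 houghton_relH)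
  |apply: (rel_braid relK)|apply: (rel_braid houghton_relH)
  |apply: (rel_triple relK)|apply: (rel_triple houghton_relH)].
Qed.

Let snd_star_tr y : (star_tr gK tK y).2 = star_tr gH tH y.
Proof.
by case: y => i m; rewrite /star_tr /=; elim: m => [//|m IHm] /=; rewrite -IHm.
Qed.

(** [K] has no given map to [houghton 3], but the product has its second projection, to which
    [normal_form_faithful] applies. *)
Lemma pair_faithful (a : K * houghton 3) : normal_form gK tK a -> a.2 = 1 -> a = 1.
Proof.
apply: (@normal_form_faithful _ _ _ relKH (fun z => z.2)) => // [y|i k].
  by rewrite snd_star_tr star_tr_gH.
exact: tl_gH.
Qed.

Lemma pair_rel : houghton_rel gK tK. Proof. exact: relKH. Qed.
End FaithfulPair.

(** At most two star transpositions bring the image of [off_star p] back to it, after which [p]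
    leaves the support. When [F] is empty, injectivity forces [star] to be fixed too. *)
Lemma finitary_star_prod (F : seq ('I_3 * nat)) f :
  (forall y, y \notin F -> f (off_star y) = off_star y) ->
  exists s, f = star_prod gH tH s.
Proof.
elim: F f => [|p F IHF] f fF.
  exists [::]; rewrite /star_prod big_nil; apply: houghton_off_ext => [|y].
    case: (off_starP (f star)) => [-> //|[y e]].
    have /h_inj e' : f star = f (off_star y) by rewrite e fF.
    by have := off_star_neq y; rewrite -e' eqxx.
  by rewrite fF.
have TK q f' : htr star (off_star q) * (htr star (off_star q) * f') = f'.
  by rewrite mulgA htr2 mul1g.
have fixF f' : f' (off_star p) = off_star p ->
    (forall y, y != p -> y \notin F -> f' (off_star y) = off_star y) ->
    exists s, f' = star_prod gH tH s.
  move=> f'p f'F; apply: IHF => y yF; have [->//|yp] := eqVneq y p.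
  exact: f'F.
have fF' y : y != p -> y \notin F -> f (off_star y) = off_star y.
  by move=> yp yF; apply: fF; rewrite inE negb_or yp.
have trF q y : y != q -> htr star (off_star q) (off_star y) = off_star y.
  by move=> yq; rewrite htrD ?off_star_neq ?(inj_eq off_star_inj).
case: (off_starP (f (off_star p))) => [fp|[q fp]].
  have [|y yp yF|s e] := fixF (htr star (off_star p) * f).
  - by rewrite hM fp htrl.
  - by rewrite hM fF' // trF.
  by exists (p :: s); rewrite star_prod_cons -e star_tr_gH TK.
have [eqp|qp] := eqVneq q p; first by apply: fixF => //; rewrite fp eqp.
have [|y yp yF|s e] := fixF (htr star (off_star p) * (htr star (off_star q) * f)).
- by rewrite !hM fp htrr htrl.
- have yq : y != q.
    apply/eqP => yq; have := fF' y yp yF; rewrite {2}yq -fp.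
    by move/h_inj/off_star_inj/eqP; rewrite (negbTE yp).
  by rewrite !hM fF' // !trF.
by exists (q :: p :: s); rewrite !star_prod_cons -e !star_tr_gH !TK.
Qed.

(* [f] maps the box of side [M] onto the box with sides [M + tl f i]. *)
Lemma tl_sum f : (tl f p0 + tl f p1 + tl f p2 = 0)%R.
Proof.
pose box (a b c : nat) : seq ('I_3 * nat) :=
  map (pair p0) (iota 0 a) ++ map (pair p1) (iota 0 b) ++ map (pair p2) (iota 0 c).
have pairI i : injective (pair i : nat -> 'I_3 * nat) by move=> ? ? [].
have mem_pair i k a m : ((k, m) \in map (pair i) (iota 0 a)) = (k == i) && (m < a)%N.
  apply/mapP/andP => [[j ja [-> ->]]|[/eqP -> ma]].
    by rewrite eqxx; rewrite mem_iota in ja.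
  by exists m; rewrite ?mem_iota.
have boxE a b c k m : ((k, m) \in box a b c) =
    [|| (k == p0) && (m < a), (k == p1) && (m < b) | (k == p2) && (m < c)]%N.
  by rewrite !mem_cat !mem_pair.
have box_uniq a b c : uniq (box a b c).
  rewrite !cat_uniq !map_inj_uniq // !iota_uniq /= andbT.
  apply/andP; split; apply/hasPn => -[k m]; rewrite ?mem_cat !mem_pair.
    by case/orP => /andP[/eqP -> _].
  by case/andP => /eqP ->.
have box_size a b c : size (box a b c) = (a + (b + c))%N.
  by rewrite !size_cat !size_map !size_iota.
have far : exists N, forall i m (k : nat), (N <= m)%N ->
    (m%:Z + tl f i = k%:Z)%R -> f (i, m) = (i, k).
  have [N0 h0] := tl_far f p0; have [N1 h1'] := tl_far f p1; have [N2 h2] := tl_far f p2.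
  exists (N0 + N1 + N2)%N => i m k le_m; have [->|->|->] := ord3P i;
    [apply: h0|apply: h1'|apply: h2]; lia.
have [N fN] := far.
(* Beyond [M] the map [f] is a translation on each prong, and [M + tl f i] is non-negative. *)
pose M := (N + `|tl f p0| + `|tl f p1| + `|tl f p2|)%N.
pose b i := `|(M%:Z + tl f i)%R|%N.
have bE i : ((b i)%:Z = M%:Z + tl f i :> int)%R.
  by rewrite /b /M; have [->|->|->] := ord3P i; lia.
have fM i m : (M <= m)%N -> f (i, m) = (i, m - M + b i)%N.
  by move=> le_m; apply: fN; [rewrite /M in le_m; lia|have := bE i; lia].
have in_box i m : ((i, m) \in box (b p0) (b p1) (b p2)) = (m < b i)%N.
  by rewrite boxE; have [->|->|->] := ord3P i; rewrite /= ?orbF.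
have in_boxM i m : ((i, m) \in box M M M) = (m < M)%N.
  by rewrite boxE; have [->|->|->] := ord3P i; rewrite /= ?orbF.
have sub_box : {subset map f (box M M M) <= box (b p0) (b p1) (b p2)}.
  move=> _ /mapP[x xM ->]; case e: (f x) => [i m]; rewrite in_box ltnNge.
  apply/negP => bm; have : f (i, m - b i + M)%N = (i, m).
    by rewrite fM ?addnK ?subnK ?leq_addl.
  rewrite -e => /h_inj ex; move: xM; rewrite -ex in_boxM ltnNge leq_addl //.
have sub_box' : {subset box (b p0) (b p1) (b p2) <= map f (box M M M)}.
  move=> [i m]; rewrite in_box => mb; apply/mapP.
  exists (f^-1 (i, m)); last by rewrite hKV.
  case e: (f^-1 (i, m)) => [k j]; rewrite in_boxM ltnNge; apply/negP => Mj.
  have := fM k j Mj; rewrite -e hKV => -[ik em].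
  by move: mb; rewrite em -ik ltnNge leq_addl.
have := uniq_leq_size _ sub_box; rewrite (map_inj_uniq (@h_inj f)) box_uniq => /(_ isT).
have := uniq_leq_size (box_uniq _ _ _) sub_box'.
rewrite !size_map !box_size; have := bE p0; have := bE p1; have := bE p2; lia.
Qed.

Lemma houghton_normal f : exists s a b,
  f = star_prod gH tH s * (zpow (gH p0) a * zpow (gH p1) b).
Proof.
(* Among the two shifts only [gH p0] translates [p1], by -1, and only [gH p1] translates [p0], by 1;
   [tl_sum] takes care of [p2]. *)
pose a := (- tl f p1)%R; pose b := tl f p0.
pose h := zpow (gH p0) a * zpow (gH p1) b.
have [s e] : exists s, f * h^-1 = star_prod gH tH s.
  have tl0 i : tl (f * h^-1) i = 0%R.
    have tlMi (x y : houghton 3) : tl (x * y) i = (tl x i + tl y i)%R by apply: tlM.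
    rewrite tlM (additiveV tlMi) /h tlM !(additive_zpow tlMi) !tl_gH.
    have := tl_sum f; rewrite /a /b.
    by have [->|->|->] := ord3P i; rewrite /shift_tl /=; lia.
  have far i : exists N, forall m, (N <= m)%N -> (f * h^-1) (i, m) = (i, m).
    have [N hN] := tl_far (f * h^-1) i; exists N => m Nm.
    by apply: hN; rewrite // tl0 addr0.
  have [N0 h0] := far p0; have [N1 h1'] := far p1; have [N2 h2] := far p2.
  pose N := (N0 + N1 + N2)%N.
  apply: (@finitary_star_prod [seq (i, m) | i <- enum 'I_3, m <- iota 0 N]).
  move=> [i m] nF; have Nm : (N <= m)%N.
    rewrite leqNgt; apply: contra nF => mN; apply/allpairsP; exists (i, m) => /=.
    by split; rewrite ?mem_enum ?mem_iota.
  rewrite off_starE; have [->|->|->] := ord3P i;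
    [apply: h0|apply: h1'|apply: h2]; rewrite /N /= in Nm *; lia.
by exists s, a, b; rewrite -e mulgVK.
Qed.
End HoughtonGenerators.

(** * The finite presentation *)

Section HoughtonPresentation.

Definition gens (G : groupType) (g t : 'I_3 -> G) (k : 'I_(3 + 3)) : G :=
  match fintype.split k with inl i => g i | inr i => t i end.

Let ag (i : 'I_3) : 'I_(3 + 3) * bool := (lshift 3 i, false).
Let agV (i : 'I_3) : 'I_(3 + 3) * bool := (lshift 3 i, true).
Let at_ (i : 'I_3) : 'I_(3 + 3) * bool := (rshift 3 i, false).

Definition relation (u v : word (3 + 3)) := u ++ winv v.

(** The relators follow the order of the fields of [houghton_rel]. *)
Definition relators_at (i : 'I_3) (j := nx i) (k := nx (nx i)) : seq (word (3 + 3)) :=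
  [:: relation [:: ag i; at_ j; agV i] [:: at_ k];
      relation [:: ag i; at_ i; agV i] [:: at_ i];
      relation [:: ag j; ag i; ag k] [::];
      relation [:: agV j; ag i; ag j] [:: at_ k; ag i; at_ k; agV i; at_ k; ag i];
      relation [:: at_ i; at_ i] [::];
      relation [:: at_ i; at_ j; at_ i] [:: at_ j; at_ i; at_ j];
      relation [:: at_ i; at_ j; at_ i; at_ k] [:: at_ k; at_ i; at_ j; at_ i]].

Definition houghton_relators : seq (word (3 + 3)) :=
  flatten [seq relators_at i | i <- enum 'I_3].

Section Eval.
Variables (G : groupType) (x : 'I_(3 + 3) -> G).
Let g i := x (lshift 3 i).
Let t i := x (rshift 3 i).

Let eval_relation u v : word_eval x (relation u v) = 1 <-> word_eval x u = word_eval x v.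
Proof.
by rewrite word_eval_cat word_evalV; split=> [/divg1_eq//|->]; rewrite mulgV.
Qed.

Let evalE := (@word_eval_cons _ _ x, @word_eval_nil _ _ x, @mulg1 G).

Lemma houghton_relatorsP :
  (forall r, r \in houghton_relators -> word_eval x r = 1) <-> houghton_rel g t.
Proof.
have memr i r : r \in relators_at i -> r \in houghton_relators.
  by move=> ri; apply/flatten_mapP; exists i; rewrite ?mem_enum.
split=> [x1|[r1 r2 r3 r4 r5 r6 r7] r /flatten_mapP[i _]].
  have x1i i m : (m < 7)%N -> word_eval x (nth [::] (relators_at i) m) = 1.
    by move=> m7; apply/x1/(memr i)/mem_nth.
  by split=> i; rewrite /tau;
    [have /eval_relation := x1i i 0%N isT|have /eval_relation := x1i i 1%N isT
    |have /eval_relation := x1i i 2%N isT|have /eval_relation := x1i i 3%N isT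
    |have /eval_relation := x1i i 4%N isT|have /eval_relation := x1i i 5%N isT
    |have /eval_relation := x1i i 6%N isT]; rewrite !evalE /= ?mulgA.
rewrite !inE => /or4P[/eqP->|/eqP->|/eqP->|/or4P[/eqP->|/eqP->|/eqP->|/eqP->]];
  apply/eval_relation; rewrite !evalE /= ?mulgA.
- exact: r1.
- exact: r2.
- exact: r3.
- by have := r4 i; rewrite /tau ?mulgA.
- exact: r5.
- by have := r6 i; rewrite /tau ?mulgA.
- by have := r7 i; rewrite /tau ?mulgA.
Qed.

Lemma word_eval_normal_form w : houghton_rel g t -> normal_form g t (word_eval x w).
Proof.
move=> rel; elim: w => [|[k e] w IHw].
  by rewrite word_eval_nil; apply: normal_form1.
rewrite word_eval_cons -[k](splitK (m := 3)) /=.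
case: (fintype.split k) => i; case: e => /=.
- exact: normal_form_gV.
- exact: normal_form_g.
- exact: normal_form_tV.
- exact: normal_form_t.
Qed.
End Eval.

Lemma gens_lshift (G : groupType) (g t : 'I_3 -> G) i : gens g t (lshift 3 i) = g i.
Proof. by rewrite /gens (unsplitK (inl i)). Qed.

Lemma gens_rshift (G : groupType) (g t : 'I_3 -> G) i : gens g t (rshift 3 i) = t i.
Proof. by rewrite /gens (unsplitK (inr i)). Qed.

Let xH := gens gH tH.

Let gHE : (fun i => xH (lshift 3 i)) = gH.
Proof. by apply/funext => i; apply: gens_lshift. Qed.

Let tHE : (fun i => xH (rshift 3 i)) = tH.
Proof. by apply/funext => i; apply: gens_rshift. Qed.

Let gen_closed (f : houghton 3) : exists w, word_eval xH w = f.
Proof.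
pose W f := exists w, word_eval xH w = f.
have W1 : W 1 by exists [::]; rewrite word_eval_nil.
have WM f1 f2 : W f1 -> W f2 -> W (f1 * f2).
  by move=> [w1 <-] [w2 <-]; exists (w1 ++ w2); rewrite word_eval_cat.
have WV f1 : W f1 -> W f1^-1.
  by move=> [w <-]; exists (winv w); rewrite word_evalV.
have WX f1 m : W f1 -> W (f1 ^+ m).
  by move=> Wf; elim: m => [|m IHm]; rewrite ?expg0 ?expgS //; apply: WM.
have WZ f1 z : W f1 -> W (zpow f1 z).
  by case: z => m Wf; apply: WX => //; apply: WV.
have Wg i : W (gH i).
  exists [:: (lshift 3 i, false)].
  by rewrite word_eval_cons word_eval_nil mulg1 /= /xH gens_lshift.
have Wt i : W (tH i).
  exists [:: (rshift 3 i, false)].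
  by rewrite word_eval_cons word_eval_nil mulg1 /= /xH gens_rshift.
have WT y : W (star_tr gH tH y).
  case: y => i m; rewrite /star_tr /=; elim: m => [|m IHm] /=; first exact: Wt.
  exact: (WM _ _ (WM _ _ (Wg (nx i)) IHm) (WV _ (Wg (nx i)))).
have [s [a [b ->]]] := houghton_normal f.
apply: (WM _ _); last by apply: (WM _ _); apply: WZ.
by elim: s => [|y s IHs]; rewrite ?star_prod_cons ?/star_prod ?big_nil //; apply: WM.
Qed.

Lemma houghton3_finitely_presented : finitely_presented (houghton 3).
Proof.
have relH : houghton_rel (fun i => xH (lshift 3 i)) (fun i => xH (rshift 3 i)).
  by rewrite gHE tHE; apply: houghton_relH.
apply: (@presentation_criterion _ _ xH houghton_relators gen_closed).
  exact/houghton_relatorsP.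
move=> K y /houghton_relatorsP relK w xw.
(* The word is evaluated in [K] and in [houghton 3] at once; a trivial second component then forces
   a trivial first one. *)
pose z k : K * houghton 3 := (y k, xH k).
have zw v : word_eval z v = (word_eval y v, word_eval xH v).
  by elim: v => [|[k []] v IHv]; rewrite ?word_eval_nil // !word_eval_cons IHv.
have relz : houghton_rel (fun i => z (lshift 3 i)) (fun i => z (rshift 3 i)).
  by have := pair_rel relK; rewrite -gHE -tHE.
have nf := word_eval_normal_form w relz.
have := @pair_faithful _ _ _ relK (word_eval z w).
rewrite -gHE -tHE => /(_ nf); rewrite zw /= => /(_ xw) [].
by [].
Qed.
End HoughtonPresentation.

Theorem corollary2p10 :
  finitely_presented (houghton 3) /\
  (exists (T : 'I_3 -> tree) (rho : action (houghton 3) T),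
     preserves_factors rho /\ proper_action rho) /\
  (forall (n : nat) (T : 'I_n -> tree),
     (forall i : 'I_n, locally_finite (T i)) ->
     ~ exists rho : action (houghton 3) T, proper_action rho).
Proof.
split; first exact: houghton3_finitely_presented.
split=> [|n T lfT [rho]]; last exact: not_proper_action.
exists ray_tree, ray_rho; split; [exact: ray_rho_pure|exact: ray_rho_proper].
Qed.
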